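(* For every $n$, the $f$-vector of the $n$-dimensional double path hypercube graph associahedron is equal to the $f$-vector of the $n$-dimensional cyclohedron.
   Context: Let $\pm[n]=\{-n,\dots,-1,1,\dots,n\}$. The double path hypercube graph is the graph on $\pm[n]$ with edges $\{i,i+1\}$ and $\{-i,-(i+1)\}$ for $1\le i<n$, and no other edges. A tube is a nonempty subset of $\pm[n]$ inducing a connected subgraph and containing no pair $\{i,-i\}$. Two tubes are weakly compatible if one is contained in the other, or they are disjoint with no edge between them. A tubing is a set of pairwise weakly compatible tubes whose union contains no pair $\{i,-i\}$. The hypercube graph associahedron is the simple $n$-dimensional polytope whose dual simplicial complex (sets of facets with nonempty intersection) is isomorphic to the complex of tubings, so its $k$-dimensional faces correspond to tubings with $n-k$ tubes. The $n$-dimensional cyclohedron is the simple polytope whose codimension-$k$ faces correspond, with reverse inclusion, to sets of $k$ pairwise compatible tubes of the cycle graph on $n+1$ vertices, where here a tube is a nonempty proper subset of vertices inducing a connected subgraph, and two tubes are compatible if one contains the other or they are disjoint and non-adjacent. The $f$-vector of a polytope lists the numbers of its $k$-dimensional faces, $0\le k\le n$. *)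

(* Defs.v *)
From HB Require Import structures.
From mathcomp Require Import all_boot all_order all_algebra.
From mathcomp Require Import finmap.
From mathcomp Require Import boolp classical_sets functions cardinality reals.

Set Implicit Arguments.
Unset Strict Implicit.
Unset Printing Implicit Defensive.

Import Order.TTheory GRing.Theory Num.Theory.

(** * Polytopes *)

Section Polytopes.
Context {R : realType} {d : nat}.
Local Open Scope ring_scope.
Local Open Scope classical_set_scope.

Implicit Types (P F G : set 'rV[R]_d) (c x : 'rV[R]_d).

Definition inner c x : R := \sum_(i < d) c ord0 i * x ord0 i.

(* A bounded intersection of finitely many closed half-spaces; the empty set
   is allowed here and is excluded by the dimension conditions below. *)
Definition polytope P : Prop :=
  (exists m (A : 'M[R]_(m, d)) (b : 'I_m -> R),
     P = [set x | forall i, inner (row i A) x <= b i]) /\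
  (exists M : R, forall x, P x -> forall i, `|x ord0 i| <= M).

(* Both [P] itself (c = 0, b = 0) and [set0] (c = 0, b = 1) are faces. *)
Definition face P F : Prop :=
  exists c (b : R), (forall x, P x -> inner c x <= b) /\
    F = [set x | P x /\ inner c x = b].

(* The rows p_i of [p] are affinely independent: the vectors (1, p_i) are
   linearly independent, i.e. sum_i l_i = 0 and sum_i l_i p_i = 0 only for
   l = 0. *)
Definition aff_indep m (p : 'M[R]_(m, d)) : bool :=
  row_free (row_mx (const_mx 1 : 'cV[R]_m) p).

(* [F] has affine dimension k: k + 1 is the largest number of affinely
   independent points of [F].  In particular [set0] has no dimension in nat. *)
Definition has_dim F (k : nat) : Prop :=
  (exists p : 'M[R]_(k.+1, d), (forall i, F (row i p)) /\ aff_indep p) /\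
  (forall p : 'M[R]_(k.+2, d), (forall i, F (row i p)) -> ~~ aff_indep p).

Definition faces_of_dim P (k : nat) : set (set 'rV[R]_d) :=
  [set F | face P F /\ has_dim F k].

Definition facets P : set (set 'rV[R]_d) :=
  [set F | face P F /\ exists k, has_dim F k /\ has_dim P k.+1].

Definition simple_polytope (n : nat) P : Prop :=
  [/\ polytope P, has_dim P n &
      forall F, faces_of_dim P 0 F ->
        ([set G | facets P G /\ F `<=` G] #= `I_n)%card].

(* Sets of faces of a polytope are finite, so that [fset_set] does not take
   its default value (the empty set) here. *)
Definition fvector (n : nat) P : n.+1.-tuple nat :=
  [tuple #|` fset_set (faces_of_dim P k)|%fset | k < n.+1].

End Polytopes.

(** * Connected vertex sets in a finite graph *)

Section Graphs.
Variables (V : finType) (e : rel V).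
Implicit Types A B : {set V}.

Definition induces_connected A : bool :=
  [forall x in A, forall y in A,
     connect [rel u v | [&& u \in A, v \in A & e u v]] x y].

Definition edge_between A B : bool :=
  [exists x in A, exists y in B, e x y].

Definition weakly_compatible A B : bool :=
  [|| A \subset B, B \subset A | [disjoint A & B] && ~~ edge_between A B].

End Graphs.

(** * Hypercube graph associahedra *)

(* The set {-n, .., -1, 1, .., n}: the pair (s, i) stands for i + 1 if s is
   true and for -(i + 1) if s is false. *)
Definition pm (n : nat) : finType := (bool * 'I_n)%type.

Definition pm_opp n (x : pm n) : pm n := (~~ x.1, x.2).

Definition double_path n : rel (pm n) := fun x y =>
  (x.1 == y.1) && ((x.2.+1 == y.2 :> nat) || (y.2.+1 == x.2 :> nat)).

Definition no_opposite n (A : {set pm n}) : bool :=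
  [forall x in A, pm_opp x \notin A].

Definition hc_tube n (e : rel (pm n)) (A : {set pm n}) : bool :=
  [&& A != finset.set0, induces_connected e A & no_opposite A].

Definition hc_tubing n (e : rel (pm n)) (S : {set {set pm n}}) : bool :=
  [&& [forall A in S, hc_tube e A],
      [forall A in S, forall B in S, weakly_compatible e A B] &
      no_opposite (finset.cover S)].

(* The isomorphism between the complex of tubings and the dual complex of [P]
   is given by its action [phi] on vertices, from tubes to facets.  The
   intersection of the empty set of facets is [P]. *)
Definition hypercube_graph_associahedron (R : realType) (d n : nat)
    (e : rel (pm n)) (P : set 'rV[R]_d) : Prop :=
  simple_polytope n P /\
  exists phi : {set pm n} -> set 'rV[R]_d,
    set_bij [set A | hc_tube e A]%classic (facets P) phi /\
    forall S : {set {set pm n}}, {in S, forall A, hc_tube e A} ->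
      (hc_tubing e S <->
       exists x, P x /\ forall A, A \in S -> phi A x).

Definition double_path_associahedron (R : realType) (d n : nat)
    (P : set 'rV[R]_d) : Prop :=
  hypercube_graph_associahedron (@double_path n) P.

(** * Cyclohedra *)

Definition cycle_graph (m : nat) : rel 'I_m := fun i j =>
  (i != j) && ((j == i.+1 %[mod m]) || (i == j.+1 %[mod m])).

Definition graph_tube (V : finType) (e : rel V) (A : {set V}) : bool :=
  [&& A != finset.set0, A != [set: V]%SET & induces_connected e A].

(* For graph associahedra, compatibility of two tubes is the same condition as
   [weakly_compatible]. *)
Definition graph_tubing (V : finType) (e : rel V) (S : {set {set V}}) : bool :=
  [forall A in S, graph_tube e A] &&
  [forall A in S, forall B in S, weakly_compatible e A B].

(* [psi] maps sets of k pairwise compatible tubes bijectively to nonempty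
   faces of codimension k, reversing inclusions. *)
Definition cyclohedron (R : realType) (d n : nat) (P : set 'rV[R]_d) : Prop :=
  simple_polytope n P /\
  exists psi : {set {set 'I_n.+1}} -> set 'rV[R]_d,
    [/\ set_bij [set S | graph_tubing (@cycle_graph n.+1) S]%classic
                [set F | face P F /\ (F !=set0)%classic]%classic psi,
        forall S T, graph_tubing (@cycle_graph n.+1) S ->
          graph_tubing (@cycle_graph n.+1) T ->
          (S \subset T <-> (psi T `<=` psi S)%classic) &
        forall S, graph_tubing (@cycle_graph n.+1) S ->
          exists k, has_dim (psi S) k /\ (k + #|S| = n)%N].

(* Main.v *)
Require Import Defs.
From mathcomp Require Import all_boot all_order all_algebra.
From mathcomp Require Import ring lra zify.

(** Polytope side.  Write a simple polytope as a system of equations and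
    irredundant inequalities.  The inequalities are then in bijection with the
    facets, and at a vertex simplicity says that exactly [n] of them are tight;
    these drop the rank from [n] to [0], so they are independent.  Hence the
    faces of dimension [k] are in bijection with the sets of [n - k] facets that
    have a common point, and both f-vectors count tubings by cardinality.

    Tubing side.  Let [t] mark tubes and [x] mark vertices, and let [h] be the
    series of the tubings of a path by proper tubes; put [B = 1 + t h].
    Splitting a family of tubes at its largest tube through a given vertex gives
    [h = x g B] with [g = 1 + (1 + t) h] the series of all tubings of a path,
    [D = B / (2 - B - x B)] for the double path, and
    [C = g + (1 + x g) theta (t h)], [theta = x d/dx], for the cycle, where the
    largest tube through a vertex can be placed in as many ways as it has
    vertices.  The equations for [h] and [g] give
    [(B - 1) (1 - x B) = t x B ^ 2]; applying [theta] to it yields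
    [(2 - B - x B) theta B = B (B - 1)], whence [C = D]. *)

Set Implicit Arguments.
Unset Strict Implicit.
Unset Printing Implicit Defensive.

Import Order.TTheory GRing.Theory Num.Theory.
Local Open Scope ring_scope.

(** * Families of compatible tubes *)

Section Families.
Variables (V : finType) (tube : pred {set V}) (adj : rel V).
Variables (K : comNzRingType) (t : K).
Hypothesis tube0 : ~~ tube set0.
Hypothesis adj_sym : symmetric adj.
Implicit Types (A B T U : {set V}) (S : {set {set V}}).

(** Compatibility refers to a relation [adj] that may have more edges than the graph whose connected
    sets are the tubes; the double path makes use of this freedom. *)
Definition families U : {set {set {set V}}} :=
  [set S : {set {set V}} | [forall A in S, tube A && (A \subset U)] &&
           [forall A in S, forall B in S, weakly_compatible adj A B]].

Definition family_gf U : K := \sum_(S in families U) t ^+ #|S|.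

Definition proper_family_gf U : K :=
  \sum_(S in families U | U \notin S) t ^+ #|S|.

Definition closed_nbhd T : {set V} := T :|: [set x | [exists y in T, adj y x]].

Lemma weakly_compatible_sym A B :
  weakly_compatible adj A B = weakly_compatible adj B A.
Proof.
rewrite /weakly_compatible disjoint_sym orbCA; congr [|| _, _ | _ && ~~ _].
by apply/exists_inP/exists_inP => -[x xA /exists_inP[y yB xy]];
  exists y => //; apply/exists_inP; exists x; rewrite // adj_sym.
Qed.

Lemma familiesP U S :
  reflect ((forall A, A \in S -> tube A /\ A \subset U) /\
           (forall A B, A \in S -> B \in S -> weakly_compatible adj A B))
          (S \in families U).
Proof.
rewrite inE; apply: (iffP andP) => -[H1 H2]; split.
- by move=> A /(forall_inP H1) /andP.
- by move=> A B /(forall_inP H2) /forall_inP /[apply].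
- by apply/forall_inP => A /H1 /andP.
- by apply/forall_inP => A AS; apply/forall_inP => B; apply: H2.
Qed.

Lemma family_gf0 : family_gf set0 = 1.
Proof.
rewrite /family_gf (big_pred1 set0) ?cards0 // => S /=.
apply/familiesP/eqP => [[H _]|->]; last by split=> A; rewrite inE.
apply/eqP/set0Pn => -[A /H[tA]]; rewrite subset0 => /eqP A0.
by move: tube0; rewrite -A0 tA.
Qed.

(** A tube [T] is compatible with all of its subsets, so it can be added to or removed from any
    family inside [T]: absent it contributes [1], present it contributes [t]. *)
Lemma family_gf_tube T : tube T -> family_gf T = (1 + t) * proper_family_gf T.
Proof.
move=> tT; rewrite /family_gf (bigID (fun S => T \in S)) /= addrC mulrDl mul1r.
congr (_ + _); rewrite /proper_family_gf big_distrr /=.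
rewrite (reindex_onto (fun S => T |: S) (fun S => S :\ T)) /=; last first.
  by move=> S /andP[_ TS]; rewrite setD1K.
apply: eq_big => S.
  rewrite setU11 andbT; apply/andP/andP => [[/familiesP[H1 H2] /eqP E]|].
    have TS : T \notin S by rewrite -E !inE eqxx.
    split=> //; apply/familiesP; split=> [A AS|A B AS BS].
      by apply: H1; rewrite inE AS orbT.
    by apply: H2; rewrite inE ?AS ?BS orbT.
  move=> [/familiesP[H1 H2] TS]; rewrite setU1K //; split=> //.
  have TT A : A \in T |: S -> A \subset T.
    by case/setU1P => [->//|/H1[]].
  apply/familiesP; split=> [A AS|A B AS BS].
    by split; [case/setU1P: AS => [->//|/H1[]]|exact: TT].
  case/setU1P: (AS) => [->|AS']; first by rewrite /weakly_compatible (TT _ BS) orbT.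
  case/setU1P: (BS) => [->|BS']; first by rewrite /weakly_compatible (TT _ AS).
  exact: H2.
move=> /andP[_ /eqP E].
have TS : T \notin S by rewrite -E !inE eqxx.
by rewrite cardsU1 TS exprS.
Qed.

(** Turns separation from [T] into avoidance of a set, so that the tubes separated from [T] again
    range over the subsets of some vertex set. *)
Lemma sep_closed_nbhd A T :
  [disjoint A & T] && ~~ edge_between adj A T = [disjoint A & closed_nbhd T].
Proof.
apply/andP/idP => [[dAT nAT]|].
  rewrite disjoint_subset; apply/subsetP => x xA; rewrite !inE negb_or.
  rewrite (disjointFr dAT xA) /=; apply: contra nAT => /exists_inP[y yT yx].
  by apply/exists_inP; exists x => //; apply/exists_inP; exists y; rewrite // adj_sym.
rewrite !disjoint_subset => /subsetP H; split.
  by apply/subsetP => x /H; rewrite !inE; case/norP.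
apply/exists_inP => -[x xA /exists_inP[y yT xy]].
move: (H _ xA); rewrite !inE negb_or => /andP[_ /exists_inP[]].
by exists y; rewrite // adj_sym.
Qed.

(** Either alternative of the disjunction excludes [T \subset A], since [v] lies in [T]. *)
Lemma weakly_compatible_cover A T v : v \in T -> ~~ (T \subset A) || (v \notin A) ->
  weakly_compatible adj A T -> A \subset T \/ [disjoint A & closed_nbhd T].
Proof.
move=> vT H; rewrite /weakly_compatible sep_closed_nbhd; case/or3P; [by left| |by right].
by move=> TA; move: H; rewrite TA (subsetP TA) //.
Qed.

(** In a compatible family the members through [v] form a chain, so their union is the largest of
    them; it is empty when no member contains [v]. *)
Definition top_tube v S : {set V} := \bigcup_(A in S | v \in A) A.

Lemma top_tube_mem U v S : S \in families U -> v \in top_tube v S ->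
  top_tube v S \in S.
Proof.
move=> /familiesP[H1 H2] /bigcupP[A0 /andP[A0S vA0] _].
have [A /andP[AS vA] Amax] := @arg_maxnP _ A0 (fun A => (A \in S) && (v \in A))
  (fun A => #|A|) (introT andP (conj A0S vA0)).
suff -> : top_tube v S = A by [].
apply/eqP; rewrite eqEsubset; apply/andP; split; last first.
  by apply: bigcup_sup; rewrite AS.
apply/bigcupsP => B /andP[BS vB].
case/or3P: (H2 _ _ AS BS) => [AB||/andP[dAB _]] //.
  have := Amax B; rewrite BS vB => /(_ isT) leBA.
  by have /eqP -> : A == B by rewrite eqEcard AB.
by move: (disjointFr dAB vA); rewrite vB.
Qed.

Lemma top_tube_sup v S A : A \in S -> v \in A -> A \subset top_tube v S.
Proof. by move=> AS vA; apply: bigcup_sup; rewrite AS. Qed.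

Section Split.
Variables (U T : {set V}) (v : V).
Hypotheses (vT : v \in T) (TU : T \subset U) (tT : tube T).

(** [join] and [split_] are inverse to each other between the pairs satisfying [dom] and the
    families in [U] whose largest tube through [v] is [T]: the members other than [T] lie either
    properly inside [T] or away from its closed neighbourhood. *)
Let join (p : {set {set V}} * {set {set V}}) := T |: (p.1 :|: p.2).
Let split_ S :=
  ([set A in S | A \proper T], [set A in S | ~~ (A \subset T)]).

Let dom p := [&& p.1 \in families T, T \notin p.1 &
                 p.2 \in families (U :\: closed_nbhd T)].

Let snd_disj p A : dom p -> A \in p.2 -> [disjoint A & closed_nbhd T].
Proof.
case/and3P=> _ _ /familiesP[H _] /H[_]; rewrite subsetD.
by case/andP.
Qed.

Let snd_nsub p A : dom p -> A \in p.2 -> ~~ (A \subset T).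
Proof.
move=> dp Ap; have := snd_disj dp Ap; rewrite -sep_closed_nbhd => /andP[d _].
apply/negP => AT; case/and3P: dp => _ _ /familiesP[/(_ _ Ap)[tA _] _].
have A0 : A == set0.
  apply/eqP/setP => x; rewrite inE; apply/negP => xA.
  by move: (disjointFr d xA); rewrite (subsetP AT).
by move: tube0; rewrite -(eqP A0) tA.
Qed.

Let fst_proper p A : dom p -> A \in p.1 -> A \proper T.
Proof.
case/and3P=> /familiesP[H _] Tp _ Ap; have [_ AT] := H _ Ap.
by rewrite properEneq AT andbT; apply: contraNneq Tp => <-.
Qed.

Let join_families p : dom p -> join p \in families U /\ top_tube v (join p) = T.
Proof.
move=> dp; have /and3P[/familiesP[H1 H2] Tp /familiesP[H3 H4]] := dp.
have sub1 A : A \in T |: p.1 -> A \subset T by case/setU1P => [->//|/H1[]].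
have wc A B : A \in T |: p.1 -> B \in p.2 -> weakly_compatible adj B A.
  move=> /sub1 AT /(snd_disj dp); rewrite -sep_closed_nbhd => /andP[d ne].
  rewrite /weakly_compatible; apply/or3P/Or33/andP; split.
    exact: disjointWr AT d.
  apply: contra ne => /exists_inP[x xB /exists_inP[y yA xy]].
  by apply/exists_inP; exists x => //; apply/exists_inP; exists y; rewrite ?(subsetP AT).
have wc1 A B : A \in T |: p.1 -> B \in T |: p.1 -> weakly_compatible adj A B.
  move=> Ap Bp; rewrite /weakly_compatible.
  case/setU1P: (Ap) => [->|Ap1]; first by rewrite (sub1 _ Bp) orbT.
  case/setU1P: (Bp) => [->|Bp1]; first by rewrite (sub1 _ Ap).
  exact: H2.
have F : join p \in families U.
  apply/familiesP; split=> [A|A B]; rewrite /join setUA.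
    case/setUP=> [/setU1P[->//|/H1[tA AT]]|/H3[tA]].
      by split=> //; apply: subset_trans TU.
    by rewrite subsetD => /andP[].
  case/setUP=> Ap /setUP[] Bp; first exact: wc1.
  - by rewrite weakly_compatible_sym wc.
  - exact: wc.
  - exact: H4.
split=> //; apply/eqP; rewrite eqEsubset top_tube_sup ?setU11 // andbT.
apply/bigcupsP => A /andP[]; rewrite /join setUA.
case/setUP=> [/sub1 //|/(snd_disj dp)]; rewrite -sep_closed_nbhd => /andP[d _] vA.
by move: (disjointFr d vA); rewrite vT.
Qed.

Let split_dom S : S \in families U -> top_tube v S = T ->
  dom (split_ S) /\ join (split_ S) = S.
Proof.
move=> SU ST; have TS : T \in S by rewrite -ST (top_tube_mem SU) // ST.
have /familiesP[H1 H2] := SU.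
split; last first.
  apply/setP => A; rewrite !inE.
  have [-> //|AT] := eqVneq A T; rewrite properEneq AT /=.
  by rewrite -andb_orr orbN andbT.
rewrite /dom /=; apply/and3P; split.
- apply/familiesP; split=> [A|A B]; rewrite !inE.
    by case/andP => /H1[tA _] /proper_sub.
  by move=> /andP[AS _] /andP[BS _]; apply: H2.
- by rewrite inE properxx andbF.
apply/familiesP; split=> [A|A B]; rewrite !inE; last first.
  by move=> /andP[AS _] /andP[BS _]; apply: H2.
case/andP=> AS nAT; have [tA AU] := H1 _ AS; split=> //.
rewrite subsetD AU /=.
(* A member that contained [T] would pass through [v], hence lie inside the top tube [T], contrary
   to [nAT]. *)
case: (weakly_compatible_cover vT _ (H2 _ _ AS TS)) => [|AT|//].
  have [vA|_] := boolP (v \in A); last exact: orbT.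
  by move: (top_tube_sup AS vA) nAT; rewrite ST => ->.
by rewrite AT in nAT.
Qed.

Let split_join p : dom p -> split_ (join p) = p.
Proof.
move=> dp; case: p dp => p1 p2 dp; rewrite /split_ /join /=.
congr (_, _); apply/setP => A; rewrite !inE.
  have [->|AT] := eqVneq A T.
    by rewrite properxx; case/and3P: dp => _ /negPf ->.
  case A1: (A \in p1) => /=; first exact: fst_proper dp A1.
  by case A2: (A \in p2) => //=; apply/negP => /proper_sub; apply/negP: (snd_nsub dp A2).
have [->|AT] := eqVneq A T.
  by rewrite subxx /=; apply/esym/negP => /(snd_nsub dp); rewrite subxx.
case A2: (A \in p2); first by rewrite orbT (snd_nsub dp A2).
by rewrite orbF /=; apply/negP => /andP[/(fst_proper dp)/proper_sub ->].
Qed.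

Lemma families_top_tube :
  \sum_(S in families U | top_tube v S == T) t ^+ #|S| =
  t * proper_family_gf T * family_gf (U :\: closed_nbhd T).
Proof.
rewrite (reindex_onto join split_) /=; last first.
  by move=> S /andP[SU /eqP ST]; have [] := split_dom SU ST.
have E p : (join p \in families U) && (top_tube v (join p) == T) &&
    (split_ (join p) == p) = dom p.
  apply/idP/idP => [/andP[/andP[pU /eqP pT] /eqP pE]|dp].
    by have [+ _] := split_dom pU pT; rewrite pE.
  by have [-> ->] := join_families dp; rewrite split_join // !eqxx.
rewrite (eq_bigl dom) // /proper_family_gf /family_gf -mulrA big_distrlr /=.
rewrite pair_big_dep /= big_distrr /=.
apply: eq_big => [p|p dp]; first by rewrite /dom andbA.
rewrite -!exprD -exprS; congr (_ ^+ _); rewrite cardsU1 cardsU.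
have -> : p.1 :&: p.2 = set0.
  apply/setP => A; rewrite !inE; apply/negP => /andP[A1 /(snd_nsub dp)].
  by rewrite (proper_sub (fst_proper dp A1)).
have -> : T \notin p.1 :|: p.2.
  rewrite inE negb_or; case/and3P: (dp) => _ -> _ /=.
  by apply/negP => /(snd_nsub dp); rewrite subxx.
by rewrite cards0 subn0.
Qed.

End Split.

(** The basic recurrence, applied below to paths, to the double path and to the cycle. Families are
    sorted by their largest tube through [v]; those without a tube through [v] are the families in
    [U :\ v]. *)
Theorem family_gf_vertex U v : v \in U ->
  family_gf U = family_gf (U :\ v) +
    \sum_(T : {set V} | [&& tube T, v \in T & T \subset U])
       t * proper_family_gf T * family_gf (U :\: closed_nbhd T).
Proof.
move=> vU; rewrite {1}/family_gf (partition_big (top_tube v) predT) //=.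
rewrite (bigID (fun T => v \in T)) /= addrC; congr (_ + _).
  rewrite (exchange_big_dep (mem (families U))) /=; last by move=> T S _ /andP[].
  rewrite (bigID (fun S => v \in top_tube v S)) /= big1 ?add0r; last first.
    by move=> S /andP[SU vS]; rewrite big_pred0 // => T; rewrite SU /=; case: eqP => [<-|];
      rewrite ?vS ?andbF.
  rewrite /family_gf [RHS]big_mkcond [LHS]big_mkcond; apply: eq_bigr => S _.
  have -> : (S \in families (U :\ v)) = (S \in families U) && (v \notin top_tube v S).
    apply/familiesP/andP => [[H1 H2]|[/familiesP[H1 H2] vS]].
      split; last first.
        by apply/bigcupP => -[A /andP[/H1[_ AU] vA] _]; move: (subsetP AU _ vA); rewrite !inE eqxx.
      by apply/familiesP; split=> // A /H1[tA]; rewrite subsetD1 => /andP[].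
    split=> // A AS; have [tA AU] := H1 _ AS; split=> //.
    rewrite subsetD1 AU /=; apply: contra vS => vA.
    by apply/bigcupP; exists A; rewrite ?AS.
  case: ifP => // /andP[SU vS]; rewrite (big_pred1 (top_tube v S)) // => T.
  by rewrite SU /= eq_sym; case: eqP => [->|]; rewrite ?vS ?andbF.
rewrite [RHS]big_mkcond [LHS]big_mkcond; apply: eq_bigr => T _.
case: (boolP (v \in T)) => vT; last by rewrite andbF.
case: (boolP (tube T && (T \subset U))) => [/andP[tT TU]|nT].
  by rewrite -(families_top_tube vT).
rewrite big1 // => S /andP[SU /eqP ST].
have TS : T \in S by rewrite -ST (top_tube_mem SU) // ST.
by case/familiesP: SU => /(_ _ TS)[tT TU]; rewrite tT TU in nT.
Qed.

End Families.

(** * Connected sets, and segments of an embedded path *)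

Section Connected.
Variables (V : finType) (e : rel V).
Implicit Types A B : {set V}.

(** Induction along a walk inside [A] from [x]. It serves to confine tubes: to a segment, to one
    side of the double path, to an arc. *)
Lemma connected_closed A B x : induces_connected e A -> x \in A -> x \in B ->
  (forall y z, y \in A -> z \in A -> y \in B -> e y z -> z \in B) -> A \subset B.
Proof.
move=> /forall_inP cA xA xB cl; apply/subsetP => y yA.
have /connectP[p + ->] := forall_inP (cA _ xA) _ yA.
elim: p x xA xB {yA} => //= z p IH x xA xB /andP[/and3P[_ zA xz]].
by apply: IH; rewrite ?zA // (cl x).
Qed.

Lemma connected_root A r : symmetric e ->
  (forall x, x \in A ->
     connect [rel u v | [&& u \in A, v \in A & e u v]] r x) ->
  induces_connected e A.
Proof.
move=> es H; apply/forall_inP => x xA; apply/forall_inP => y yA.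
apply: connect_trans (H _ yA); rewrite sym_connect_sym; first exact: H.
by move=> u v /=; rewrite es andbCA.
Qed.

Lemma big_sets_inj (R : nmodType) (I : finType) (h : I -> {set V})
    (P : pred {set V}) (X : {set V} -> R) :
  injective h -> (forall T, P T <-> exists i, T = h i) ->
  \sum_(T | P T) X T = \sum_i X (h i).
Proof.
move=> hI HP; transitivity (\sum_(T in h @: setT) X T); last first.
  rewrite big_imset /=; last by move=> i j _ _; apply: hI.
  by apply: eq_bigl => i; rewrite inE.
apply: eq_bigl => T; apply/idP/imsetP => [/HP[i ->]|[i _ ->]]; first by exists i.
by apply/HP; exists i.
Qed.

End Connected.

Section Segments.
Variables (V : finType) (m : nat) (f : 'I_m -> V).
Hypothesis f_inj : injective f.
Variables (e : rel V).
Hypothesis e_sym : symmetric e.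
Hypothesis e_path : forall i j, e (f i) (f j) = (i.+1 == j :> nat) || (j.+1 == i :> nat).

Implicit Types A B T : {set V}.

(** The interval is half-open and its bounds are plain numbers, so the empty segments and those
    reaching the end of the path need no special form. *)
Definition segment a b : {set V} := f @: [set i : 'I_m | a <= i < b]%N.

Lemma mem_segment a b i : (f i \in segment a b) = (a <= i < b)%N.
Proof. by rewrite mem_imset // inE. Qed.

Lemma segmentP a b x :
  reflect (exists2 i : 'I_m, (a <= i < b)%N & x = f i) (x \in segment a b).
Proof.
by apply: (iffP imsetP) => -[i]; rewrite ?inE => H ->; exists i; rewrite ?inE.
Qed.

Lemma segment_ext A B : A \subset codom f -> B \subset codom f ->
  (forall i, (f i \in A) = (f i \in B)) -> A = B.
Proof.
move=> /subsetP As /subsetP Bs H; apply/setP => x.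
by apply/idP/idP => xX; [have /codomP[i xi] := As _ xX|have /codomP[i xi] := Bs _ xX];
  move: xX; rewrite xi H.
Qed.

Lemma segment_codom a b : segment a b \subset codom f.
Proof. by apply/subsetP => x /segmentP[i _ ->]; apply: codom_f. Qed.

Lemma segment_sub a b a' b' : (a' <= a)%N -> (b <= b')%N ->
  segment a b \subset segment a' b'.
Proof. by move=> la lb; apply/subsetP => x /segmentP[i Hi ->]; rewrite mem_segment; lia. Qed.

Lemma segment_empty a b : (b <= a)%N -> segment a b = set0.
Proof.
move=> ba; apply/eqP/set0Pn => -[x /segmentP[i Hi _]]; lia.
Qed.

Lemma segment_vertex (i : 'I_m) b : segment i b :\ f i = segment i.+1 b.
Proof.
apply: segment_ext; rewrite ?segment_codom //.
  exact: subset_trans (subsetDl _ _) (segment_codom i b).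
by move=> j; rewrite !inE !mem_segment // (inj_eq f_inj) -val_eqE /=; lia.
Qed.

Lemma segment_connected a b : induces_connected e (segment a b).
Proof.
have [ba|ab] := leqP b a.
  by rewrite segment_empty //; apply/forall_inP => x; rewrite inE.
have [am|ma] := ltnP a m; last first.
  rewrite (_ : segment a b = set0); first by apply/forall_inP => x; rewrite inE.
  by apply/eqP/set0Pn => -[x /segmentP[i Hi _]]; move: (ltn_ord i); lia.
apply: (@connected_root _ _ _ (f (Ordinal am))) => // x /segmentP[i Hi ->].
move: i Hi => [k km] /=; elim: k km => [|k IH] km Hk.
  by rewrite (_ : Ordinal am = Ordinal km) ?connect0 //; apply: val_inj => /=; lia.
have [ak|ak] := leqP a k; last first.
  by rewrite (_ : Ordinal am = Ordinal km) ?connect0 //; apply: val_inj => /=; lia.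
have km' : (k < m)%N by lia.
apply: connect_trans (IH km' _) _; first by lia.
by apply: connect1; rewrite /= !mem_segment e_path /=; lia.
Qed.

(** Take [c] to be one more than the largest index occurring in [T]. If some [f k] with [i < k < c]
    were missing, no edge inside [T] would leave [segment i k], and the last vertex of [T] could not
    be reached from [f i]. *)
Lemma segment_of_connected (i : 'I_m) T b : T \subset segment i b -> f i \in T ->
  induces_connected e T -> exists2 c : nat, (i < c <= b)%N & T = segment i c.
Proof.
move=> /subsetP Tb iT cT.
have ex : exists c, [exists j : 'I_m, (f j \in T) && (j.+1 == c)].
  by exists i.+1; apply/existsP; exists i; rewrite iT eqxx.
have bd c : [exists j : 'I_m, (f j \in T) && (j.+1 == c)] -> (c <= m)%N.
  by move=> /existsP[j /andP[_ /eqP <-]].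
have [c /existsP[j /andP[jT /eqP jc]] cmax] := ex_maxnP ex bd.
have jmax k : f k \in T -> (k < c)%N.
  by move=> kT; apply: cmax; apply/existsP; exists k; rewrite kT eqxx.
exists c; first by move: (jmax _ iT) (Tb _ jT); rewrite mem_segment; lia.
apply: segment_ext; rewrite ?segment_codom //.
  by apply/subsetP => x /Tb /segmentP[k _ ->]; apply: codom_f.
move=> k; apply/idP/idP => [kT|].
  by move: (Tb _ kT); rewrite !mem_segment (jmax _ kT) andbT => /andP[].
rewrite mem_segment => /andP[ik kc]; apply: contraT => kT.
have ik' : (i < k)%N.
  by rewrite ltn_neqAle ik andbT; apply: contraNneq kT => /val_inj <-.
have := @connected_closed _ e T (segment i k) (f i) cT iT.
rewrite mem_segment leqnn ik' => /(_ isT) cl.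
have /subsetP : T \subset segment i k.
  apply: cl => y z yT zT /segmentP[p Hp yp].
  have /segmentP[q Hq zq] := Tb _ zT.
  rewrite yp zq e_path mem_segment // => pq.
  have : q != k by apply: contraNneq kT => <-; rewrite -zq.
  by rewrite -val_eqE /=; lia.
move=> /(_ _ jT); rewrite mem_segment => /andP[_ jk].
have : j != k by apply: contraNneq kT => <-.
by rewrite -val_eqE /=; lia.
Qed.

End Segments.

(** * The coefficients of the path series [h] and [g] *)

Section PathNumbers.
Variables (K : comNzRingType) (t : K).

(** Coefficient of [g = 1 + (1 + t) h]: the whole path may or may not be added as a tube, except
    that the empty path carries only the empty tubing. *)
Definition with_full_tube (h : nat -> K) m : K := (m == 0%N)%:R + (1 + t) * h m.

Definition path_step (h : nat -> K) m : K :=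
  if m is k.+1 then with_full_tube h k +
    \sum_(c < k) t * h c.+1 * with_full_tube h (k - c.+1)%N
  else 0.

(** The recurrence for [h] uses all earlier coefficients, so they are collected in a list.
    [path_step] at [k] reads only indices below [k], and the default of [nth] is never taken. *)
Fixpoint path_seq m : seq K :=
  if m is k.+1 then rcons (path_seq k) (path_step (nth 0 (path_seq k)) k)
  else [::].

Definition path_proper_gf m : K := nth 0 (path_seq m.+1) m.

Definition path_gf := with_full_tube path_proper_gf.

Lemma size_path_seq m : size (path_seq m) = m.
Proof. by elim: m => //= m IH; rewrite size_rcons IH. Qed.

Lemma nth_path_seq m k : (k < m)%N -> nth 0 (path_seq m) k = path_proper_gf k.
Proof.
elim: m => // m IH; rewrite ltnS leq_eqVlt => /orP[/eqP->//|km].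
by rewrite /= nth_rcons size_path_seq km IH.
Qed.

Lemma path_proper_gf0 : path_proper_gf 0 = 0.
Proof. by []. Qed.

Lemma path_gf0 : path_gf 0 = 1.
Proof. by rewrite /path_gf /with_full_tube eqxx path_proper_gf0 mulr0 addr0. Qed.

Lemma path_gfS m : path_gf m.+1 = (1 + t) * path_proper_gf m.+1.
Proof. by rewrite /path_gf /with_full_tube add0r. Qed.

(** Coefficient form of [h = x g B]. *)
Lemma path_proper_gfS m : path_proper_gf m.+1 =
  path_gf m + \sum_(c < m) t * path_proper_gf c.+1 * path_gf (m - c.+1)%N.
Proof.
rewrite /path_proper_gf [path_seq _]/= nth_rcons size_rcons size_path_seq ltnn eqxx.
set s := rcons _ _; have E k : (k <= m)%N -> nth 0 s k = path_proper_gf k.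
  by move=> km; rewrite -(@nth_path_seq m.+1).
rewrite /path_step /with_full_tube E //; congr (_ + _); apply: eq_bigr => c _.
have cm := ltn_ord c.
by rewrite !E ?leq_subr // -/(path_proper_gf _).
Qed.

End PathNumbers.

(** * Families of tubes supported on an embedded path *)

Section PathFamilies.
Variables (V : finType) (tube : pred {set V}) (adj e : rel V).
Variables (K : comNzRingType) (t : K).
Hypothesis e_sym : symmetric e.
Variables (m : nat) (f : 'I_m -> V).
Hypothesis f_inj : injective f.
Hypothesis e_path : forall i j, e (f i) (f j) = (i.+1 == j :> nat) || (j.+1 == i :> nat).
Hypothesis adj_path : forall i j, adj (f i) (f j) = (i.+1 == j :> nat) || (j.+1 == i :> nat).
Hypothesis tube_path : forall T : {set V}, T \subset codom f ->
  tube T = (T != set0) && induces_connected e T.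

Lemma tube_segment (a b : nat) : (a < b <= m)%N -> tube (segment f a b).
Proof.
move=> /andP[ab bm]; rewrite tube_path ?segment_codom // segment_connected // andbT.
have am : (a < m)%N by lia.
by apply/set0Pn; exists (f (Ordinal am)); rewrite mem_segment //= leqnn.
Qed.

(** A tube in a segment that contains the first vertex is an initial segment, so it is determined by
    its length [c.+1]. *)
Lemma big_segment_tubes (R : nmodType) (X : {set V} -> R) (i : 'I_m) b :
  (b <= m)%N ->
  \sum_(T : {set V} | [&& tube T, f i \in T & T \subset segment f i b]) X T =
  \sum_(c < (b - i)%N) X (segment f i (i + c.+1)%N).
Proof.
move=> bm; apply: big_sets_inj => [c c' /setP E|T].
  have lc := ltn_ord c; have lc' := ltn_ord c'.
  apply: val_inj => /=.
  have km k : (k < b - i)%N -> (i + k < m)%N by lia.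
  have := E (f (Ordinal (km _ lc))); have := E (f (Ordinal (km _ lc'))).
  by rewrite !mem_segment //= ; lia.
split=> [/and3P[tT iT Ts]|[c ->]].
  have Tc : T \subset codom f by apply: subset_trans Ts (segment_codom f i b).
  move: tT; rewrite tube_path // => /andP[_ cT].
  have [c Hc ->] := segment_of_connected f_inj e_path Ts iT cT.
  have Hc' : (c - i.+1 < b - i)%N by lia.
  by exists (Ordinal Hc') => /=; congr segment; lia.
have lc := ltn_ord c.
rewrite tube_segment ?mem_segment ?segment_sub //=; lia.
Qed.

(** The neighbourhood swallows the next vertex [f c] as well, so the rest starts at [c.+1]. *)
Lemma segment_nbhd (i : 'I_m) (b c : nat) : (i < c <= b)%N ->
  segment f i b :\: closed_nbhd adj (segment f i c) = segment f c.+1 b.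
Proof.
move=> Hc; apply: (@segment_ext _ _ f); rewrite ?segment_codom //.
  exact: subset_trans (subsetDl _ _) (segment_codom f i b).
move=> j; rewrite !inE !mem_segment //.
case: (ltnP j c) => jc /=; first by rewrite andbT; case: leqP => /=; lia.
rewrite andbF /= (_ : [exists y in _, _] = (j == c :> nat)); first by lia.
apply/exists_inP/eqP => [[y /segmentP[k Hk ->]]|jc'].
  by rewrite adj_path; lia.
have cm : (c.-1 < m)%N by have := ltn_ord j; lia.
by exists (f (Ordinal cm)); rewrite ?mem_segment // ?adj_path /=; lia.
Qed.

Hypothesis tube0 : ~~ tube set0.
Hypothesis adj_sym : symmetric adj.

(** Strong induction on the length, with the recurrence taken at the first vertex. Both equalities
    go through the induction together: initial tubes call for the second, remaining segments for the
    first. *)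
Theorem segment_family_gf a b : (a <= b <= m)%N ->
  family_gf tube adj t (segment f a b) = path_gf t (b - a)%N /\
  ((a < b)%N -> proper_family_gf tube adj t (segment f a b) = path_proper_gf t (b - a)%N).
Proof.
have [k] := ubnP (b - a)%N; elim: k a b => // k IH a b; rewrite ltnS => Hk /andP[ab bm].
have [ba|{}ab] := leqP b a.
  have -> : (b - a = 0)%N by lia.
  by rewrite segment_empty // path_gf0 family_gf0 //; split=> //; rewrite ltnNge ba.
have [i Ei] : exists i : 'I_m, a = i.
  by have am : (a < m)%N by [lia]; exists (Ordinal am).
have tS : tube (segment f a b) by rewrite tube_segment ?ab.
subst a; have iS : f i \in segment f i b by rewrite mem_segment //= leqnn.
suff E : proper_family_gf tube adj t (segment f i b) = path_proper_gf t (b - i)%N.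
  split=> //; rewrite family_gf_tube // E.
  by rewrite (_ : b - i = (b - i).-1.+1)%N ?path_gfS //; lia.
have [n En] : exists n, (b - i = n.+1)%N by exists (b - i).-1; lia.
have := family_gf_vertex t tube0 adj_sym iS.
rewrite family_gf_tube // segment_vertex // (big_segment_tubes _ _ bm).
have [-> _] := IH i.+1 b ltac:(lia) ltac:(lia).
(* The last summand, where the tube is the whole segment, equals the [t] part of the factor [1 + t]
   on the left; [addIr] cancels the two. *)
rewrite En big_ord_recr /= segment_nbhd; last by rewrite /=; lia.
rewrite (_ : i + n.+1 = b)%N; last by lia.
rewrite [segment f b.+1 b]segment_empty // family_gf0 // mulr1 mulrDl mul1r addrA.
move/addIr => ->; rewrite path_proper_gfS; congr (_ + _); first by congr path_gf; lia.
apply: eq_bigr => c _; have lc := ltn_ord c.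
rewrite segment_nbhd /=; last by lia.
have [_ ->] := IH i (i + c.+1)%N ltac:(lia) ltac:(lia); last by lia.
have [-> _] := IH (i + c.+1).+1 b ltac:(lia) ltac:(lia).
by congr (_ * path_proper_gf _ _ * path_gf _ _); lia.
Qed.

End PathFamilies.

(** * Generating functions *)

Section GeneratingFunctions.
Variables (K : comNzRingType) (t : K).

Lemma coefM_shift (p q : {poly K}) k : p`_0 = 0 ->
  (p * q)`_k = \sum_(c < k) p`_c.+1 * q`_(k - c.+1).
Proof. by move=> p0; rewrite coefM big_ord_recl p0 mul0r add0r. Qed.

(** Congruence modulo ['X^N] is stated with an explicit remainder, so that later eliminations are
    polynomial identities that [ring] can check. *)
Lemma eq_mod_Xn N (p q : {poly K}) : (forall i, (i < N)%N -> p`_i = q`_i) ->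
  exists r, p = q + 'X^N * r.
Proof.
move=> H; exists (drop_poly N (p - q)).
rewrite -{1}(subrK q p) addrC; congr (_ + _).
rewrite -[LHS](poly_take_drop N) mulrC (_ : take_poly N _ = 0) ?add0r //.
by apply/polyP => i; rewrite coef_take_poly coef0 coefB; case: ifP => // /H ->; rewrite subrr.
Qed.

(** The Euler operator. Unlike the plain derivative it sends multiples of ['X^N] to multiples of
    ['X^N], so the truncation order survives. *)
Definition theta (p : {poly K}) : {poly K} := 'X * p^`().

Lemma thetaM p q : theta (p * q) = theta p * q + p * theta q.
Proof. by rewrite /theta derivM; ring. Qed.

Lemma thetaD p q : theta (p + q) = theta p + theta q.
Proof. by rewrite /theta derivD mulrDr. Qed.

Lemma thetaN p : theta (- p) = - theta p.
Proof. by rewrite /theta derivN mulrN. Qed.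

Lemma thetaC c : theta c%:P = 0.
Proof. by rewrite /theta derivC mulr0. Qed.

Lemma theta1 : theta 1 = 0.
Proof. exact: thetaC. Qed.

Lemma thetaX : theta 'X = 'X.
Proof. by rewrite /theta derivX mulr1. Qed.

Lemma theta_Xn N : theta 'X^N = N%:R * 'X^N.
Proof. by case: N => [|N]; rewrite /theta derivXn ?mulr0n ?mulr0 ?mul0r // mulrnAr -exprS mulr_natl. Qed.

(* The series are truncated: [r1], [r3] and [r4] are the remainders. *)
Lemma series_identity (N : nat) (h D E r1 r3 r4 : {poly K}) :
  h = 'X * (1 + (1 + t%:P) * h) * (1 + t%:P * h) + 'X^N * r1 ->
  E = 1 + 'X * D + t%:P * h * E + 'X^N * r3 ->
  D = E + t%:P * h * E + 'X^N * r4 ->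
  exists r, 1 + (1 + t%:P) * h + theta (t%:P * h) * (1 + 'X * (1 + (1 + t%:P) * h)) =
            D + 'X^N * r.
Proof.
set y := 'X^N; set x := 'X; set T := t%:P; set B := 1 + T * h.
set g := 1 + (1 + T) * h => H1 H3 H4.
have H1' : h - (x * g * B + y * r1) = 0 by rewrite -H1 subrr.
(* The common denominator: modulo [y], [E] is the inverse of [u], and [D] is [B * E]. *)
pose u := 2 - B - x * B.
have HE : E * u - 1 - y * (x * r4 + r3) = 0.
  have -> : E * u - 1 - y * (x * r4 + r3) =
    (E - (1 + x * D + T * h * E + y * r3)) + x * (D - (E + T * h * E + y * r4)).
    by rewrite /u /B; ring.
  by rewrite -H3 -H4 !subrr mulr0 addr0.
pose r5 := T * r1.
(* Elimination of [g] from the two equations that define [h] and [g]. *)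
have quad : (B - 1) * (1 - x * B) = T * (x * (B * B)) + y * r5.
  apply/eqP; rewrite -subr_eq0; apply/eqP.
  have -> : (B - 1) * (1 - x * B) - (T * (x * (B * B)) + y * r5) =
     T * (h - (x * g * B + y * r1)) by rewrite /r5 /g /B; ring.
  by rewrite H1' mulr0.
have [r6 dquad] : exists r6,
    theta B * (1 - x * B) - (B - 1) * (x * B + x * theta B) =
    T * (x * (B * B) + x * (2 * (B * theta B))) + y * r6.
  exists (N%:R * r5 + theta r5).
  move: quad; move: (B) (r5) => B0 r0 /(congr1 theta).
  rewrite !(thetaM, thetaD, thetaN) theta_Xn !(thetaC, theta1, thetaX) -/x -/y => H.
  by apply: etrans (etrans _ H) _; ring.
have [r7 key] : exists r7, theta B * u - B * (B - 1) - y * r7 = 0.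
  exists (B * (r6 - r5) - 2 * (theta B * r5)).
  move/eqP: dquad; rewrite -subr_eq0 => /eqP dq; move/eqP: quad; rewrite -subr_eq0 => /eqP q.
  rewrite /u; move: (B) (r5) (r6) (theta B) q dq => B0 s5 s6 tB q dq.
  (* The multipliers [B0] and [B0 + 2 * tB] are chosen so that the terms with [T] cancel between
     [quad] and its image under [theta]. *)
  rewrite (_ : _ - _ = B0 * (tB * (1 - x * B0) - (B0 - 1) * (x * B0 + x * tB) -
    (T * (x * (B0 * B0) + x * (2 * (B0 * tB))) + y * s6)) -
    (B0 + 2 * tB) * ((B0 - 1) * (1 - x * B0) - (T * (x * (B0 * B0)) + y * s5))).
    by rewrite dq q !mulr0 subr0.
  by ring.
have tA : theta (T * h) = theta B by rewrite /B thetaD theta1 add0r.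
rewrite tA; set c := g + _.
have hE : h = g - B by rewrite /g /B; ring.
rewrite hE in H1'.
pose r8 := 2 * r1 - B * r1 + (1 + x * g) * r7.
have cu : c * u - B - y * r8 = 0.
  rewrite (_ : _ - _ = (1 + x * g) * (theta B * u - B * (B - 1) - y * r7) +
     (2 - B) * (g - B - (x * g * B + y * r1))); first by rewrite key H1' !mulr0 addr0.
  by rewrite /c /r8 /u; move: (g) (B) => g0 B0; ring.
exists (E * r8 - r4 - c * (x * r4 + r3)).
apply/eqP; rewrite -subr_eq0; apply/eqP.
have HD : D - (B * E + y * r4) = 0.
  by apply/eqP; rewrite subr_eq0; apply/eqP; rewrite [LHS]H4 /B; ring.
rewrite (_ : _ - _ = E * (c * u - B - y * r8) - c * (E * u - 1 - y * (x * r4 + r3))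
  - (D - (B * E + y * r4))); first by rewrite HE cu HD !mulr0 !subr0.
by move: (c) (u) (B) (r8) => c0 u0 B0 s8; ring.
Qed.

(** Coefficient of [x ^ n] in [C = D]. The multiplicity [k.+1] comes from [theta], and as the
    recurrences are assumed only up to [n], all series are cut off modulo ['X^(n.+1)]. *)
Theorem path_gf_pointed n (D E : nat -> K) : D 0%N = 1 -> E 0%N = 1 ->
  (forall k, (k < n)%N ->
     E k.+1 = D k + \sum_(c < k.+1) t * path_proper_gf t c.+1 * E (k - c)%N) ->
  (forall k, (k < n)%N ->
     D k.+1 = E k.+1 + \sum_(c < k.+1) t * path_proper_gf t c.+1 * E (k - c)%N) ->
  path_gf t n + \sum_(k < n) (t * path_proper_gf t k.+1 * path_gf t (n - k.+2)%N) *+ k.+1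
  = D n.
Proof.
move=> D0 E0 HE HD.
pose h := \poly_(i < n.+1) path_proper_gf t i.
pose Dp := \poly_(i < n.+1) D i; pose Ep := \poly_(i < n.+1) E i.
have h0 : h`_0 = 0 by rewrite coef_poly path_proper_gf0.
have th0 : (t%:P * h)`_0 = 0 by rewrite coefCM h0 mulr0.
have gE i : (i <= n)%N -> (1 + (1 + t%:P) * h)`_i = path_gf t i.
  move=> lin; rewrite (_ : 1 + t%:P = (1 + t)%:P); last by rewrite polyCD.
  rewrite coefD coef1 coefCM coef_poly ltnS lin.
  by [].
have thE i : (i < n)%N -> (t%:P * h)`_i.+1 = t * path_proper_gf t i.+1.
  by move=> lin; rewrite coefCM coef_poly ltnS lin.
have tED k : (k < n)%N -> (t%:P * h * Ep)`_k.+1 =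
    \sum_(c < k.+1) t * path_proper_gf t c.+1 * E (k - c)%N.
  move=> kn; rewrite coefM_shift //; apply: eq_bigr => c _; have lc := ltn_ord c.
  rewrite thE ?coef_poly; last by lia.
  by rewrite subSS (_ : (k - c < n.+1)%N) //; lia.
have [r1 H1] : exists r, h = 'X * (1 + (1 + t%:P) * h) * (1 + t%:P * h) + 'X^(n.+1) * r.
  apply: eq_mod_Xn => -[|i] lin; rewrite -mulrA coefXM //= [_ * (1 + _)]mulrDr mulr1 coefD.
  rewrite [_ * (t%:P * h)]mulrC.
  rewrite coefM_shift // gE ?coef_poly ?lin; last by lia.
  rewrite path_proper_gfS; congr (_ + _); apply: eq_bigr => c _; have lc := ltn_ord c.
  by rewrite thE ?gE //; lia.
have [r3 H3] : exists r, Ep = 1 + 'X * Dp + t%:P * h * Ep + 'X^(n.+1) * r.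
  apply: eq_mod_Xn => -[|i] lin; rewrite !coefD coef1 coefXM /=.
    by rewrite coef0M th0 mul0r !addr0 coef_poly.
  by rewrite tED // !coef_poly lin add0r HE // ltnW.
have [r4 H4] : exists r, Dp = Ep + t%:P * h * Ep + 'X^(n.+1) * r.
  apply: eq_mod_Xn => -[|i] lin; rewrite !coefD.
    by rewrite coef0M th0 mul0r addr0 !coef_poly D0 E0.
  by rewrite tED // !coef_poly lin HD.
have [r /(congr1 (fun p : {poly K} => p`_n))] := series_identity H1 H3 H4.
rewrite coefD [X in X = _]coefD gE // coefXnM ltnSn addr0 coef_poly ltnSn => <-.
congr (_ + _); have tA0 : (theta (t%:P * h))`_0 = 0 by rewrite coefXM.
rewrite coefM_shift //; apply: eq_bigr => k _; have lk := ltn_ord k.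
rewrite coefXM /= coef_deriv thE // mulrnAl; congr (_ *+ _); congr (_ * _).
(* For [k.+1 = n] the constant term of [1 + x g] is met; the truncated index [n - k.+2] is then [0],
   and [path_gf] has the same value [1] there. *)
rewrite coefD coef1 coefXM; case E1 : (n - k.+1)%N => [|j].
  by rewrite addr0 (_ : n - k.+2 = 0)%N ?path_gf0 //; lia.
by rewrite add0r gE /=; [congr path_gf|]; lia.
Qed.
End GeneratingFunctions.

(** * Double path and cycle *)

Section DoublePath.
Variables (n : nat) (K : comNzRingType) (t : K).

Local Notation e := (@double_path n).
Local Notation tube := (hc_tube e).

(* Opposite vertices are adjacent, so that weakly compatible tubes have no
   opposite pair in their union. *)
Definition dp_adj : rel (pm n) := fun x y => double_path x y || (y == pm_opp x).

Definition side s (i : 'I_n) : pm n := (s, i).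

Lemma pm_oppK : involutive (@pm_opp n).
Proof. by case=> s i; rewrite /pm_opp negbK. Qed.

Lemma double_path_sym : symmetric e.
Proof. by move=> x y; rewrite /double_path eq_sym orbC. Qed.

Lemma dp_adj_sym : symmetric dp_adj.
Proof.
by move=> x y; rewrite /dp_adj double_path_sym eq_sym (inv_eq pm_oppK).
Qed.

Lemma side_inj s : injective (side s).
Proof. by move=> i j []. Qed.

Lemma double_path_side s i j :
  e (side s i) (side s j) = (i.+1 == j :> nat) || (j.+1 == i :> nat).
Proof. by rewrite /double_path eqxx. Qed.

Lemma dp_adj_side s i j :
  dp_adj (side s i) (side s j) = (i.+1 == j :> nat) || (j.+1 == i :> nat).
Proof. by rewrite /dp_adj double_path_side xpair_eqE; case: s; rewrite orbF. Qed.

Lemma codom_side s x : (x \in codom (side s)) = (x.1 == s).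
Proof.
by case: x => s' i; apply/codomP/eqP => [[j []]//|/= ->]; exists i.
Qed.

Lemma hc_tube_side s (T : {set pm n}) : T \subset codom (side s) ->
  tube T = (T != set0) && induces_connected e T.
Proof.
move=> /subsetP Ts; rewrite /hc_tube (_ : no_opposite T) ?andbT //.
apply/forall_inP => x /Ts; rewrite codom_side => /eqP xs.
by apply/negP => /Ts; rewrite codom_side /= xs; case: (s).
Qed.

Lemma hc_tube0 : ~~ tube set0.
Proof. by rewrite /hc_tube eqxx. Qed.

Lemma hc_tube_one_side s i (T : {set pm n}) : tube T -> side s i \in T ->
  T \subset codom (side s).
Proof.
move=> /and3P[_ cT _] iT.
have /subsetP H : T \subset [set x : pm n | x.1 == s].
  apply: (connected_closed cT iT); first by rewrite inE.
  by move=> y z _ _; rewrite !inE => /eqP <- /andP[/eqP ->].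
by apply/subsetP => x /H; rewrite codom_side inE.
Qed.

(** On its own side a tube gains one vertex at each end; on the other side it reaches exactly the
    opposites of its vertices. *)
Lemma side_nbhd s a b x : (a < b <= n)%N ->
  (x \in closed_nbhd dp_adj (segment (side s) a b)) =
  if x.1 == s then (a <= x.2.+1)%N && (x.2 <= b)%N else (a <= x.2 < b)%N.
Proof.
case: x => s' j /= Hab; have lj := ltn_ord j.
rewrite !inE; case: eqVneq => [->|s's].
  rewrite (mem_segment (@side_inj s)); apply/orP/idP => [[|]|Hj]; first by lia.
    by case/exists_inP => y /segmentP[k Hk ->]; rewrite dp_adj_side; lia.
  case: (boolP (a <= j < b)%N) => [|nab]; [by left|right; apply/exists_inP].
  have [jb|jb] := eqVneq (nat_of_ord j) b.
    have lb : (b.-1 < n)%N by lia.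
    exists (side s (Ordinal lb)); rewrite ?(mem_segment (@side_inj s)) ?dp_adj_side /=; lia.
  have la : (a < n)%N by lia.
  exists (side s (Ordinal la)); rewrite ?(mem_segment (@side_inj s)) ?dp_adj_side /=; lia.
have -> : s' = ~~ s by move: s's; case: s' s => -[].
rewrite (_ : _ \in _ = false) /=; last first.
  by apply/negP => /segmentP[k _ []]; case: (s).
apply/exists_inP/idP => [[y /segmentP[k Hk ->]]|Hj].
  rewrite /dp_adj /double_path /= xpair_eqE eqxx /=.
  by case: (s) => /= /eqP ->.
exists (side s j); first by rewrite (mem_segment (@side_inj s)).
by rewrite /dp_adj eqxx orbT.
Qed.

(** An opposite pair in the union lies in two different members, since tubes have none. These
    members cannot be nested, and being disjoint they would be joined by an edge of [dp_adj]. *)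
Lemma hc_tubing_families (S : {set {set pm n}}) :
  hc_tubing e S = (S \in families tube dp_adj setT).
Proof.
apply/and3P/familiesP => [[/forall_inP H1 /forall_inP H2 /forall_inP H3]|[H1 H2]].
  split=> [A AS|A B AS BS]; first by rewrite H1 ?subsetT.
  have := forall_inP (H2 _ AS) _ BS; rewrite /weakly_compatible.
  case/or3P=> [->//|->|/andP[-> nAB]]; rewrite ?orbT //=.
  suff -> : ~~ edge_between dp_adj A B by rewrite !orbT.
  apply: contra nAB => /exists_inP[x xA /exists_inP[y yB /orP[xy|/eqP yx]]].
    by apply/exists_inP; exists x => //; apply/exists_inP; exists y.
  have /H3 : x \in cover S by apply/bigcupP; exists A.
  by case/negP; apply/bigcupP; exists B; rewrite -?yx.
split; first by apply/forall_inP => A /H1[].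
  apply/forall_inP => A AS; apply/forall_inP => B BS.
  have := H2 _ _ AS BS; rewrite /weakly_compatible.
  case/or3P=> [->//|->|/andP[-> nAB]]; rewrite ?orbT //=.
  suff -> : ~~ edge_between e A B by rewrite !orbT.
  apply: contra nAB => /exists_inP[x xA /exists_inP[y yB xy]].
  by apply/exists_inP; exists x => //; apply/exists_inP; exists y; rewrite // /dp_adj xy.
apply/forall_inP => x /bigcupP[A AS xA]; apply/bigcupP => -[B BS yB].
have no C : C \in S -> x \in C -> pm_opp x \notin C.
  by move=> /H1[/and3P[_ _ /forall_inP H] _] /H.
case/or3P: (H2 _ _ AS BS) => [/subsetP AB|/subsetP BA|/andP[_ /exists_inP[]]].
- by move: (no _ BS (AB _ xA)); rewrite yB.
- by move: (no _ AS xA); rewrite (BA _ yB).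
- by exists x => //; apply/exists_inP; exists (pm_opp x); rewrite // /dp_adj eqxx orbT.
Qed.

(* The vertex [(s, a)] belongs to [dp_tail a] but not to [dp_cut s a]. *)
Definition dp_tail a : {set pm n} := [set x : pm n | a <= x.2]%N.
Definition dp_cut s a : {set pm n} := [set x : pm n | a + (x.1 == s) <= x.2]%N.

Local Notation F := (family_gf tube dp_adj t).

(** The bounds on [U] admit both tails and cuts. A tube through the leftmost vertex is an initial
    segment of its side, and its neighbourhood leaves a cut on that side, whether or not the
    opposite vertex belonged to [U]. *)
Lemma dp_vertex s (i : 'I_n) (U : {set pm n}) : side s i \in U ->
  U \subset dp_tail i -> dp_tail i.+1 \subset U ->
  F U = F (U :\ side s i) +
    \sum_(c < n - i) t * path_proper_gf t c.+1 * F (dp_cut s (i + c.+1)%N).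
Proof.
move=> iU /subsetP Ui /subsetP iU'.
rewrite (family_gf_vertex t hc_tube0 dp_adj_sym iU); congr (_ + _).
have Es : {subset segment (side s) i n <= U}.
  move=> x /segmentP[j Hj ->].
  have [<-//|ij] := eqVneq i j.
  by apply: iU'; rewrite inE /=; move: ij; rewrite -val_eqE /=; lia.
rewrite (eq_bigl (fun T => [&& tube T, side s i \in T & T \subset segment (side s) i n])); last first.
  move=> T; case tT: (tube T) => //=; case iT: (_ \in T) => //=.
  apply/subsetP/subsetP => [TU x xT|TU x /TU /Es //].
  have := subsetP (hc_tube_one_side tT iT) _ xT.
  move: (Ui _ (TU _ xT)); rewrite codom_side inE; case: x {xT} => s' j /= ij /eqP ->.
  by rewrite (mem_segment (@side_inj s)) ij /=.
rewrite (big_segment_tubes double_path_sym (@side_inj s) (@double_path_side s) (@hc_tube_side s)) //.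
apply: eq_bigr => c _; have lc := ltn_ord c.
have [_ ->] := segment_family_gf t double_path_sym
  (@side_inj s) (@double_path_side s) (@dp_adj_side s) (@hc_tube_side s)
  hc_tube0 dp_adj_sym (a := i) (b := (i + c.+1)%N)
  ltac:(lia); last by lia.
rewrite addKn; congr (_ * family_gf _ _ _ _).
apply/setP => x; rewrite inE side_nbhd ?inE; last by lia.
have ix : (i < x.2)%N -> x \in U by move=> ix; apply: iU'; rewrite inE.
have [xU|xU] := boolP (x \in U); last first.
  by have := contra ix xU; rewrite andbF -leqNgt => xi; apply/esym/negbTE; lia.
by have := Ui _ xU; rewrite inE andbT; case: eqP => _ /=; lia.
Qed.

Lemma dp_tail_empty a : (n <= a)%N -> dp_tail a = set0.
Proof. by move=> na; apply/setP => x; rewrite !inE; have := ltn_ord x.2; lia. Qed.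

Lemma dp_cut_empty s a : (n <= a)%N -> dp_cut s a = set0.
Proof. by move=> na; apply/setP => x; rewrite !inE; have := ltn_ord x.2; lia. Qed.

(** Coefficient form of [D = E + t h E], with [D] for tails and [E] for cuts. *)
Lemma dp_tail_rec s (i : 'I_n) : F (dp_tail i) = F (dp_cut s i) +
    \sum_(c < n - i) t * path_proper_gf t c.+1 * F (dp_cut s (i + c.+1)%N).
Proof.
rewrite (@dp_vertex s i) ?inE //=; last first.
  by apply/subsetP => x; rewrite !inE => /ltnW.
congr (F _ + _); apply/setP => -[s' j]; rewrite !inE xpair_eqE -val_eqE /=.
by case: eqP => _ /=; lia.
Qed.

(** Coefficient form of [E = 1 + x D + t h E], up to the side of the cuts. *)
Lemma dp_cut_rec s (i : 'I_n) : F (dp_cut (~~ s) i) = F (dp_tail i.+1) +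
    \sum_(c < n - i) t * path_proper_gf t c.+1 * F (dp_cut s (i + c.+1)%N).
Proof.
rewrite (@dp_vertex s i) ?inE /=; first last.
- by apply/subsetP => x; rewrite !inE; case: eqP => _ /=; lia.
- by apply/subsetP => x; rewrite !inE; lia.
- by case: (s); rewrite addn0.
congr (F _ + _); apply/setP => -[s' j]; rewrite !inE xpair_eqE -val_eqE /=.
by case: s' s => -[] /=; lia.
Qed.

(** The recurrence for cuts and induction on the number [k] of remaining positions replace an
    argument by the symmetry exchanging the two sides. *)
Lemma dp_cut_side k : (k <= n)%N -> F (dp_cut true (n - k)%N) = F (dp_cut false (n - k)%N).
Proof.
have [m] := ubnP k; elim: m k => // m IH [|k]; rewrite ltnS => km kn.
  by rewrite !dp_cut_empty ?subn0.
have lk : (n - k.+1 < n)%N by lia.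
rewrite (@dp_cut_rec false (Ordinal lk)) (@dp_cut_rec true (Ordinal lk)) /=.
congr (_ + _); apply: eq_bigr => c _; have lc := ltn_ord c; congr (_ * _).
rewrite (_ : n - k.+1 + c.+1 = n - (k - c))%N; last by lia.
by rewrite IH //; lia.
Qed.

Theorem double_path_gf : F setT =
  path_gf t n + \sum_(k < n) (t * path_proper_gf t k.+1 * path_gf t (n - k.+2)%N) *+ k.+1.
Proof.
rewrite (@path_gf_pointed _ _ _ (fun k => F (dp_tail (n - k)%N))
   (fun k => F (dp_cut true (n - k)%N))) /=; first last.
- move=> k kn; have lk : (n - k.+1 < n)%N by lia.
  rewrite (dp_tail_rec true (Ordinal lk)) /=; congr (_ + _).
  rewrite subKn //; apply: eq_bigr => c _; have lc := ltn_ord c.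
  by congr (_ * F (dp_cut _ _)); lia.
- move=> k kn; have lk : (n - k.+1 < n)%N by lia.
  (* This expresses a cut on side [true] through cuts on side [false]; [dp_cut_side] changes the
     side back. *)
  rewrite (dp_cut_rec false (Ordinal lk)) /=; congr (_ + _).
    by congr (F (dp_tail _)); lia.
  rewrite subKn //; apply: eq_bigr => c _; have lc := ltn_ord c.
  rewrite (_ : n - k.+1 + c.+1 = n - (k - c))%N; last by lia.
  by rewrite dp_cut_side //; lia.
- by rewrite subn0 dp_cut_empty // family_gf0 // hc_tube0.
- by rewrite subn0 dp_tail_empty // family_gf0 // hc_tube0.
by rewrite subnn; congr F; apply/setP => x; rewrite !inE.
Qed.

End DoublePath.

(** * Tubings of the cycle *)

Section Cycle.
Variables (n : nat) (K : comNzRingType) (t : K).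

Local Notation e := (@cycle_graph n.+1).
Local Notation tube := (graph_tube e).
Local Notation F := (family_gf tube e t).

Lemma cycle_graph_sym : symmetric e.
Proof. by move=> x y; rewrite /cycle_graph eq_sym orbC. Qed.

Lemma graph_tube0 : ~~ tube set0.
Proof. by rewrite /graph_tube eqxx. Qed.

Lemma graph_tubing_families S : graph_tubing e S = (S \in families tube e setT).
Proof.
rewrite inE /graph_tubing; congr (_ && _).
by apply: eq_forallb => A; rewrite subsetT andbT.
Qed.

(** A form without remainders, for linear arithmetic. The condition [x != y] matters for [n = 0],
    where the only vertex would be its own successor. *)
Lemma cycle_graphE (x y : 'I_n.+1) :
  e x y = (x != y) && [|| x.+1 == y, y.+1 == x, (x == 0 :> nat) && (y == n :> nat)
                        | (y == 0 :> nat) && (x == n :> nat)].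
Proof.
rewrite /cycle_graph; case: eqP => //= _.
have lx := ltn_ord x; have ly := ltn_ord y.
have E (a b : 'I_n.+1) : (a == b.+1 %[mod n.+1]) = (a == b.+1 :> nat) || ((b == n :> nat) && (a == 0 :> nat)).
  have la := ltn_ord a; have lb := ltn_ord b.
  rewrite (modn_small la); have [->|bn] := eqVneq (nat_of_ord b) n.
    by rewrite modnn; lia.
  by rewrite modn_small; lia.
by rewrite !E; lia.
Qed.

(** The path that starts at [p] and runs through all vertices except the last, [p + n]. The missing
    vertex makes every connected nonempty subset a proper one, so the results on paths apply. *)
Definition arc p (i : 'I_n) : 'I_n.+1 := inZp (p + i).

Lemma arc_inj p : injective (arc p).
Proof.
move=> i j /(congr1 val) /= /eqP; rewrite eqn_modDl.
have li := ltn_ord i; have lj := ltn_ord j.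
by rewrite !modn_small; [move=> /eqP /val_inj| lia | lia].
Qed.

Lemma cycle_graph_arc p i j :
  e (arc p i) (arc p j) = (i.+1 == j :> nat) || (j.+1 == i :> nat).
Proof.
have li := ltn_ord i; have lj := ltn_ord j.
rewrite /cycle_graph (inj_eq (@arc_inj p)) -val_eqE /=.
have E (a b : nat) : (a < n)%N -> (b < n)%N ->
    ((p + a) %% n.+1 == ((p + b) %% n.+1).+1 %[mod n.+1]) = (a == b.+1).
  move=> la lb; rewrite modn_mod -[(_ %% _).+1]addn1 modnDml addn1 -addnS eqn_modDl.
  by rewrite !modn_small //; lia.
by rewrite !E //; lia.
Qed.

Lemma graph_tube_arc p (T : {set 'I_n.+1}) : T \subset codom (arc p) ->
  tube T = (T != set0) && induces_connected e T.
Proof.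
move=> /subsetP Tp; rewrite /graph_tube (_ : T != setT) //.
apply/eqP => TT; have := Tp (inZp (p + n)); rewrite TT inE => /(_ isT)/codomP[i].
move/(congr1 val) => /= /eqP; rewrite eqn_modDl.
by have li := ltn_ord i; rewrite !modn_small; lia.
Qed.

(* The arc with [k.+1] vertices, [l] of which precede the vertex [0]. *)
Definition arc_around0 (k l : nat) : {set 'I_n.+1} :=
  [set x : 'I_n.+1 | (x <= k - l) || (n - l < x)]%N.

Lemma arc_around0_segment k l : (l <= k < n)%N ->
  arc_around0 k l = segment (arc (n.+1 - l)) 0 k.+1.
Proof.
move=> Hkl; apply/setP => x; rewrite inE; have lx := ltn_ord x.
apply/idP/segmentP => [Hx|[i Hi ->]]; last first.
  rewrite /=; have [il|il] := ltnP i l; first by rewrite modn_small; lia.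
  rewrite (_ : n.+1 - l + i = n.+1 + (i - l))%N; last by lia.
  by rewrite modnDl modn_small; lia.
case/orP: Hx => Hx.
  have H : (x + l < n)%N by lia.
  exists (Ordinal H) => /=; first by lia.
  apply: val_inj => /=; rewrite (_ : n.+1 - l + (x + l) = n.+1 + x)%N; last by lia.
  by rewrite modnDl modn_small.
have H : (x - (n.+1 - l) < n)%N by lia.
exists (Ordinal H) => /=; first by lia.
by apply: val_inj => /=; rewrite modn_small; lia.
Qed.

Lemma tube_arc_around0 k l : (l <= k < n)%N -> tube (arc_around0 k l).
Proof.
move=> H; rewrite arc_around0_segment //.
apply: (tube_segment cycle_graph_sym (@arc_inj _) (@cycle_graph_arc _)
  (@graph_tube_arc _)); lia.
Qed.

(** Let [p] and [q] be the least and the greatest vertex outside [T]. Connectedness keeps [T] within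
    the vertices below [p] or above [q], and all of these belong to [T]. *)
Lemma tube0_arc (T : {set 'I_n.+1}) : tube T -> ord0 \in T ->
  exists k l, (l <= k < n)%N /\ T = arc_around0 k l.
Proof.
case/and3P=> _ TT cT T0; have /set0Pn[z] : ~: T != set0.
  by apply: contraNneq TT => H; rewrite -(setCK T) H setC0.
rewrite inE => zT.
have [p pT pmin] := arg_minnP (fun x : 'I_n.+1 => nat_of_ord x) (zT : (fun x => x \notin T) z).
have [q qT qmax] := arg_maxnP (fun x : 'I_n.+1 => nat_of_ord x) (zT : (fun x => x \notin T) z).
have p0 : (0 < p)%N.
  by rewrite lt0n; apply: contraNneq pT => p0; rewrite (_ : p = ord0) //; apply: val_inj.
have lq := ltn_ord q; have pq := pmin _ qT.
(* Besides [0], the tube has [n - q] vertices before it and [p.-1] after it. *)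
exists (p.-1 + (n - q))%N, (n - q)%N; split; first by lia.
have Tsub : T \subset [set x : 'I_n.+1 | (x < p)%N || (q < x)%N].
  apply: (connected_closed cT T0); first by rewrite inE /= p0.
  move=> x y xT yT; rewrite !inE cycle_graphE => xpq /andP[_ xy].
  have yp : nat_of_ord y != p by apply: contraNneq pT => /val_inj <-.
  have yq : nat_of_ord y != q by apply: contraNneq qT => /val_inj <-.
  have := ltn_ord y; have := ltn_ord x; lia.
apply/setP => x; rewrite inE; have lx := ltn_ord x; apply/idP/idP => [/(subsetP Tsub)|].
  by rewrite inE; lia.
apply: contraLR => xT; have := pmin _ xT; have := qmax _ xT; lia.
Qed.

Lemma arc_around0_inj k l k' l' : (l <= k < n)%N -> (l' <= k' < n)%N ->
  arc_around0 k l = arc_around0 k' l' -> k = k' /\ l = l'.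
Proof.
move=> H H' /setP E.
have Ex (x : nat) : (x <= n)%N ->
    ((x <= k - l) || (n - l < x))%N = ((x <= k' - l') || (n - l' < x))%N.
  by move=> xn; have := E (inord x); rewrite !inE inordK.
have r1 : (k' - l' <= k - l)%N by have := Ex (k - l).+1; lia.
have r2 : (k - l <= k' - l')%N by have := Ex (k' - l').+1; lia.
have l1 : (l' <= l)%N by have := Ex (n - l)%N; lia.
have l2 : (l <= l')%N by have := Ex (n - l')%N; lia.
by lia.
Qed.

Lemma arc_family_gf p a b : (b <= n)%N ->
  F (segment (arc p) a b) = path_gf t (b - a)%N.
Proof.
move=> bn; have [ab|ba] := leqP a b.
  by case: (segment_family_gf t cycle_graph_sym
    (@arc_inj p) (@cycle_graph_arc p) (@cycle_graph_arc p) (@graph_tube_arc p)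
    graph_tube0 cycle_graph_sym    (a := a) (b := b)); rewrite ?ab.
have -> : (b - a = 0)%N by lia.
by rewrite path_gf0 segment_empty; [exact: family_gf0 graph_tube0|exact: ltnW].
Qed.

Lemma arc_around0_proper_gf k l : (l <= k < n)%N ->
  proper_family_gf tube e t (arc_around0 k l) = path_proper_gf t k.+1.
Proof.
move=> H; rewrite arc_around0_segment //.
have [_ ->] := segment_family_gf t cycle_graph_sym
    (@arc_inj (n.+1 - l)) (@cycle_graph_arc _) (@cycle_graph_arc _) (@graph_tube_arc _)
    graph_tube0 cycle_graph_sym (a := 0%N) (b := k.+1) ltac:(lia); last by [].
by rewrite subn0.
Qed.

Lemma mem_arc1 a b (x : 'I_n.+1) : (b <= n)%N ->
  (x \in segment (arc 1) a b) = (a < x <= b)%N.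
Proof.
move=> bn; apply/segmentP/idP => [[i Hi ->]|Hx].
  by have li := ltn_ord i; rewrite /= modn_small; lia.
have lx : (x.-1 < n)%N by lia.
exists (Ordinal lx) => /=; first by lia.
by apply: val_inj => /=; rewrite modn_small; lia.
Qed.

(** The two neighbours of the arc are lost as well, which leaves [n - k.+2] vertices; for [k.+1 = n]
    they are one and the same vertex, and the segment is empty. *)
Lemma arc_around0_nbhd k l : (l <= k < n)%N ->
  setT :\: closed_nbhd e (arc_around0 k l) =
  segment (arc 1) (k - l).+1 (n - l).-1.
Proof.
move=> H; apply/setP => x; have lx := ltn_ord x.
rewrite mem_arc1; last by lia.
rewrite !inE andbT negb_or; apply/andP/idP => [[Hx /exists_inP N]|Hx].
  have nb (y : nat) : (y <= n)%N -> ((y <= k - l) || (n - l < y))%N ->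
      y.+1 = x \/ x.+1 = y \/ (x = n :> nat /\ y = 0%N) -> False.
    move=> yn Hy xy; apply: N; exists (inord y); rewrite ?inE ?inordK //.
    rewrite cycle_graphE -val_eqE /= inordK //; lia.
  have := nb x.-1; have := nb x.+1; have := nb 0%N; lia.
split; first by lia.
apply/exists_inP => -[y]; rewrite inE cycle_graphE => Hy /andP[_].
have ly := ltn_ord y; lia.
Qed.

(** The recurrence at the vertex [0]: without it the cycle is a path on [n] vertices, and an arc of
    [k.+1] vertices through [0] has [k.+1] positions. *)
Theorem cycle_gf : F setT =
  path_gf t n + \sum_(k < n) (t * path_proper_gf t k.+1 * path_gf t (n - k.+2)%N) *+ k.+1.
Proof.
rewrite (family_gf_vertex t graph_tube0 cycle_graph_sym (in_setT ord0)); congr (_ + _).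
  rewrite (_ : setT :\ ord0 = segment (arc 1) 0 n) ?arc_family_gf ?subn0 //.
  apply/setP => x; rewrite mem_arc1 // !inE andbT -val_eqE /= lt0n.
  by rewrite -ltnS ltn_ord andbT.
transitivity (\sum_(k < n) \sum_(l < k.+1)
   t * path_proper_gf t k.+1 * path_gf t (n - k.+2)%N); last first.
  by apply: eq_bigr => k _; rewrite sumr_const card_ord.
rewrite sig_big_dep /=.
rewrite (big_sets_inj (h := fun p : {k : 'I_n & 'I_k.+1} => arc_around0 (tag p) (tagged p))).
- apply: eq_bigr => -[k l] _ /=; have lk := ltn_ord k; have ll := ltn_ord l.
  rewrite arc_around0_proper_gf ?arc_around0_nbhd ?arc_family_gf; try lia.
  by congr (_ * path_gf _ _); lia.
- move=> [k l] [k' l'] /=; have lk := ltn_ord k; have ll := ltn_ord l.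
  have lk' := ltn_ord k'; have ll' := ltn_ord l'.
  have H : (l <= k < n)%N by lia.
  have H' : (l' <= k' < n)%N by lia.
  case/(arc_around0_inj H H') => /val_inj kk; subst k'.
  by move/val_inj => ->.
move=> T; split=> [/and3P[tT T0 _]|[[k l] ->]] /=.
  have [k [l [/andP[lk kn] ->]]] := tube0_arc tT T0.
  have lk' : (l < (Ordinal kn).+1)%N by [].
  by exists (existT _ (Ordinal kn) (Ordinal lk')).
have lk := ltn_ord k; have ll := ltn_ord l.
by rewrite tube_arc_around0 ?subsetT ?inE //; lia.
Qed.

End Cycle.

(** * Comparison of the tubings by cardinality *)

Lemma family_gf_coef (V : finType) (tube : pred {set V}) (adj : rel V) U k :
  (family_gf tube adj ('X : {poly int}) U)`_k =
  #|[set S in families tube adj U | #|S| == k]|%:R.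
Proof.
rewrite /family_gf coef_sum (eq_bigr (fun S : {set {set V}} => if #|S| == k then 1 else 0)).
  rewrite -big_mkcondr /= sumr_const.
  by congr (_ *+ _); apply: eq_card => S; rewrite [in RHS]inE.
by move=> S _; rewrite coefXn eq_sym; case: eqP.
Qed.

Theorem card_tubings n k :
  #|[set S | hc_tubing (@double_path n) S & #|S| == k]| =
  #|[set S | graph_tubing (@cycle_graph n.+1) S & #|S| == k]|.
Proof.
have := congr1 (fun p : {poly int} => p`_k)
  (etrans (double_path_gf n 'X) (esym (cycle_gf n 'X))).
rewrite /= !family_gf_coef => /eqP; rewrite eqr_nat => /eqP E.
under eq_finset do rewrite hc_tubing_families.
by under [in RHS]eq_finset do rewrite graph_tubing_families.
Qed.

(** * Faces of simple polytopes *)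

From mathcomp Require Import finmap boolp classical_sets functions cardinality reals.

Local Open Scope classical_set_scope.

Lemma card_image_finset (T : finType) (U : choiceType) (X : {set T}) (f : T -> U) :
  {in X &, injective f} -> (f @` [set` X] #= `I_#|X|)%card.
Proof.
move=> f_inj; have -> : f @` [set` X] = (f \o enum_val) @` [set: 'I_#|X|].
  apply/seteqP; split=> [_ [x xX <-]|_ [i _ <-]].
    by exists (enum_rank_in xX x) => //=; rewrite enum_rankK_in.
  by exists (enum_val i) => //=; apply: enum_valP.
apply: card_eq_trans (inj_card_eq _) _; last by rewrite card_eq_sym card_II.
by move=> i j _ _ /= /f_inj /enum_val_inj; apply; apply: enum_valP.
Qed.

Lemma fset_set_image_card (T : finType) (U : choiceType) (X : {set T}) (f : T -> U) :
  {in X &, injective f} -> #|` fset_set (f @` [set` X])|%fset = #|X|.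
Proof. by move=> /card_image_finset /card_fset_set. Qed.

(** * Affine dimension and inner products *)

Section Dimension.
Variables (R : realType) (d : nat).
Implicit Types (F : set 'rV[R]_d) (x y u : 'rV[R]_d).

(** [W] is the direction space of the affine hull of [F]. Independent points are [x] and small
    displacements of [x] along a basis of [W]. *)
Lemma has_dim_affine F x (W : 'M[R]_d) : F x ->
  (forall y, F y -> (y - x <= W)%MS) ->
  (forall u, (u <= W)%MS -> exists2 eps : R, 0 < eps & F (x + eps *: u)) ->
  has_dim F (\rank W).
Proof.
move=> Fx FW WF; split.
  have /choice[eps epsP] : forall i : 'I_(\rank W), exists e : R,
      0 < e /\ F (x + e *: row i (row_base W)).
    move=> i; have [|e e0 Fe] := WF (row i (row_base W)); last by exists e.
    by apply: submx_trans (row_sub _ _) _; rewrite eq_row_base.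
  set r := \rank W in eps epsP *.
  pose q : 'M[R]_(r, d) := \matrix_i (x + eps i *: row i (row_base W)).
  pose p : 'M[R]_(1 + r, d) := col_mx x q.
  exists p; split=> [i|].
    case: (@split_ordP 1 r i) => j ->.
      by have -> : row (lshift r j) p = x by rewrite /p rowKu row_id.
    by have -> : row (rshift 1 j) p = row j q by [rewrite /p rowKd]; rewrite rowK; case: (epsP j).
  suff: row_free (row_mx (const_mx 1 : 'cV[R]_(1 + r)) p) by [].
  apply: inj_row_free => v.
  rewrite mul_mx_row => H; have /eq_row_mx[] := etrans H (esym (@row_mx0 R 1 1 d)).
  pose c : 'cV[R]_r := const_mx 1.
  rewrite -(hsubmxK v) (_ : const_mx 1 = col_mx 1%:M c); last first.
    by apply/matrixP => i j; rewrite !mxE; case: (fintype.split i) => k; rewrite !mxE ?ord1.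
  set v1 := lsubmx v; set v2 := rsubmx v; rewrite /p. rewrite !mul_row_col mulmx1.
  have -> : q = c *m x + diag_mx (\row_i eps i) *m row_base W.
    apply/matrixP => i j; rewrite mul_diag_mx !mxE big_ord1 !mxE mul1r.
    by rewrite (_ : ord0 = 0) //.
  move/addr0_eq => v1E; rewrite mulmxDr !mulmxA -v1E mulNmx addNKr => H2.
  have v20 : v2 = 0.
    have : v2 *m diag_mx (\row_i eps i) = 0.
      by apply: (row_free_inj (row_base_free W)); rewrite mul0mx -[RHS]H2 mulmxA.
    move/matrixP => E; apply/matrixP => i j; have := E i j.
    rewrite mul_mx_diag !mxE => /eqP; rewrite mulf_eq0.
    by have [/lt0r_neq0/negPf-> _] := epsP j; rewrite orbF => /eqP.
  have v10 : v1 = 0 by apply: oppr_inj; rewrite v1E v20 mul0mx oppr0.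
  by rewrite v10 v20 row_mx0.
move=> p Fp; rewrite /aff_indep /row_free neq_ltn ltnS; apply/orP; left.
pose c : 'cV[R]_(\rank W).+2 := const_mx 1.
(* A matrix of rank at most one plus a matrix whose row space has the rank of [W] at most. *)
have -> : row_mx (const_mx 1) p = c *m row_mx 1%:M x + (p - c *m x) *m row_mx 0 1%:M.
  rewrite !mul_mx_row mulmx1 mulmx0 add_row_mx addr0 mulmx1 addrC subrK //.
apply: leq_trans (mxrank_add _ _) _; apply: (@leq_add _ _ 1) (mulmx_max_rank _ _) _.
apply: leq_trans (mxrankM_maxl _ _) _; apply: mxrankS; apply/row_subP => i.
rewrite linearB /= row_mul (_ : row i c = 1%:M) ?mul1mx; first exact: FW.
by apply/matrixP => j k; rewrite !mxE !ord1.
Qed.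

Lemma row_free_rowsub m k l (f : 'I_k -> 'I_m) (M : 'M[R]_(m, l)) : injective f ->
  row_free M -> row_free (rowsub f M).
Proof.
move=> f_inj Mfree; apply: inj_row_free => v.
rewrite -[M]mul1mx -mul_rowsub_mx mulmxA => H.
have {H} := row_free_inj Mfree (etrans H (esym (mul0mx _ M))).
move/matrixP => E; apply/matrixP => i j; have := E i (f j); rewrite !mxE (bigD1 j) //=.
rewrite !mxE eqxx mulr1 big1 ?addr0 // => j' /negPf jj.
by rewrite !mxE (inj_eq f_inj) jj mulr0.
Qed.

Lemma has_dim_unique F k l : has_dim F k -> has_dim F l -> k = l.
Proof.
wlog kl : k l / (k < l)%N => [H Fk Fl|[_ Fk] [[p [pF pI]] _]].
  by case: (ltngtP k l) => // kl; [exact: H|apply/esym; exact: H].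
pose f := @widen_ord k.+2 l.+1 kl.
suff : aff_indep (rowsub f p).
  by apply: contraTeq => _; apply: Fk => i; rewrite row_rowsub.
rewrite /aff_indep (_ : row_mx _ _ = rowsub f (row_mx (const_mx 1) p)).
  by apply: row_free_rowsub pI => i j /(congr1 val) /= /val_inj.
by apply/matrixP => i j; rewrite !mxE; case: fintype.split => j'; rewrite !mxE.
Qed.

Lemma has_dim_nonempty F k : has_dim F k -> F !=set0.
Proof. by case=> -[p [pF _]] _; exists (row ord0 p). Qed.

End Dimension.

Section Inner.
Variables (R : realType) (d : nat).
Implicit Types (c x y : 'rV[R]_d).

Lemma innerD c x y : inner c (x + y) = inner c x + inner c y.
Proof. by rewrite /inner -big_split; apply: eq_bigr => i _; rewrite mxE mulrDr. Qed.

Lemma innerZ c k x : inner c (k *: x) = k * inner c x.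
Proof. by rewrite /inner big_distrr; apply: eq_bigr => i _; rewrite mxE mulrCA. Qed.

Lemma innerB c x y : inner c (x - y) = inner c x - inner c y.
Proof. by rewrite -scaleN1r innerD innerZ mulN1r. Qed.

Lemma inner0 c : inner c 0 = 0.
Proof. by rewrite /inner big1 // => i _; rewrite mxE mulr0. Qed.

Lemma inner_sum (I : finType) (J : {set I}) c (x : I -> 'rV[R]_d) :
  inner c (\sum_(i in J) x i) = \sum_(i in J) inner c (x i).
Proof. by apply: (big_morph (inner c) (innerD c) (inner0 c)). Qed.

Lemma inner_suml (I : finType) (J : {set I}) (c : I -> 'rV[R]_d) x :
  inner (\sum_(i in J) c i) x = \sum_(i in J) inner (c i) x.
Proof.
rewrite /inner exchange_big; apply: eq_bigr => k _.
by rewrite summxE mulr_suml.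
Qed.

End Inner.

(** * Solution spaces of sets of constraints *)

Section Polyhedron.
Variables (R : realType) (d m : nat) (A : 'M[R]_(m, d)).
Implicit Types (I J : {set 'I_m}) (x y z u : 'rV[R]_d).

Local Notation a i x := (inner (row i A) x).

(** The directions along which the constraints of [I] are constant. Rows outside [I] are set to
    zero, so that the matrix size does not depend on [I]. *)
Definition orth I : 'M[R]_d :=
  kermx (\matrix_(i < m) (if i \in I then row i A else 0))^T.

Lemma orthP I u : reflect (forall i, i \in I -> a i u = 0) (u <= orth I)%MS.
Proof.
have E i : (u *m (\matrix_(i < m) (if i \in I then row i A else 0))^T) ord0 i =
    if i \in I then a i u else 0.
  rewrite mxE /inner; case: ifP => iI; last by rewrite big1 // => k _; rewrite !mxE iI mxE mulr0.
  by apply: eq_bigr => k _; rewrite !mxE iI mxE mulrC.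
rewrite sub_kermx; apply: (iffP eqP) => [/matrixP H i iI|H].
  by have := H ord0 i; rewrite E iI mxE.
by apply/matrixP => k i; rewrite ord1 E mxE; case: ifP => // /H.
Qed.

(** Each further linear equation lowers the rank by at most one. *)
Lemma orth_rank_setU I J : (\rank (orth I) <= \rank (orth (I :|: J)) + #|J|)%N.
Proof.
have [k] := ubnP #|J|; elim: k J => // k IH J; rewrite ltnS => Jk.
have [->|[j jJ]] := finset.set_0Vmem J; first by rewrite finset.setU0 leq_addr.
have := IH (J :\ j); rewrite (cardsD1 j J) jJ add1n in Jk * => /(_ Jk).
set K := I :|: (J :\ j) => H; apply: leq_trans H _; rewrite addnS -addSn leq_add2r.
rewrite -(mxrank_mul_ker (orth K) (row j A)^T).
apply: (@leq_add _ _ 1) (rank_leq_col _) _.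
apply: mxrankS; apply/row_subP => i; apply/orthP => l.
have := row_sub i (orth K :&: kermx (row j A)^T)%MS.
rewrite sub_capmx => /andP[/orthP H1]; rewrite sub_kermx => /eqP H2.
rewrite -(finset.setD1K jJ) finset.setUCA => /setU1P[->|]; last exact: H1.
move/matrixP: H2 => /(_ ord0 ord0); rewrite !mxE => E.
by rewrite /inner -[RHS]E; apply: eq_bigr => p _; rewrite !mxE mulrC.
Qed.

Lemma orthS I J : I \subset J -> (orth J <= orth I)%MS.
Proof.
move=> /fintype.subsetP IJ; apply/row_subP => k; apply/orthP => i iI.
by have /orthP := row_sub k (orth J); apply; apply: IJ.
Qed.

Lemma orth_rank_lt I J u : I \subset J -> (u <= orth I)%MS -> ~~ (u <= orth J)%MS ->
  (\rank (orth J) < \rank (orth I))%N.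
Proof.
move=> IJ uI uJ; apply: rank_ltmx; rewrite ltmxE orthS //=.
by apply: contra uJ; apply: submx_trans.
Qed.

Lemma orth_rank_witness I J : I \subset J ->
  (\rank (orth J) < \rank (orth I))%N -> exists2 u : 'rV[R]_d, (u <= orth I)%MS & ~~ (u <= orth J)%MS.
Proof.
move=> IJ H; have : ~~ (orth I <= orth J)%MS.
  by apply: contraL H => /mxrankS; rewrite -leqNgt.
case/row_subPn => i ui; exists (row i (orth I)) => //; exact: row_sub.
Qed.

End Polyhedron.

Lemma exists_lower_bound (R : realType) (I : finType) (Q : pred I) (s : I -> R) :
  (forall i, Q i -> 0 < s i) -> exists2 e, 0 < e & forall i, Q i -> e <= s i.
Proof.
move=> s0; exists (\big[Num.min/1]_(i | Q i) s i); last by move=> i; apply: bigmin_le_cond.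
by apply: (big_ind (fun e => 0 < e)) => // x y x0 y0; rewrite lt_min x0.
Qed.

(* [P] is cut out by the equations of [E] and the irredundant inequalities of
   [M], all strict at [z]. *)
Section Irredundant.
Variables (R : realType) (d m : nat) (A : 'M[R]_(m, d)) (b : 'I_m -> R).
Variables (E M : {set 'I_m}) (P : set 'rV[R]_d) (z : 'rV[R]_d).
Local Notation a i x := (inner (row i A) x).
Hypothesis PE : forall x, P x <->
  (forall i, i \in E -> a i x = b i) /\ (forall i, i \in M -> a i x <= b i).
Hypothesis Pz : P z.
Hypothesis z_int : forall i, i \in M -> a i z < b i.
Hypothesis irr : forall i, i \in M -> exists y,
  [/\ forall j, j \in E -> a j y = b j,
      forall j, j \in M -> j != i -> a j y <= b j & b i < a i y].
Hypothesis Pbounded : exists B : R, forall x, P x -> forall i, `|x ord0 i| <= B.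
Implicit Types (x y u : 'rV[R]_d) (J K : {set 'I_m}) (G : set 'rV[R]_d).

Local Notation W J := (orth A (E :|: J)).

Definition active x : {set 'I_m} := [set i in M | a i x == b i]%SET.

Definition face_of J : set 'rV[R]_d := [set x | P x /\ forall i, i \in J -> a i x = b i].

Lemma activeP x i : reflect (i \in M /\ a i x = b i) (i \in active x).
Proof. by rewrite inE; apply: (iffP andP) => -[H /eqP]. Qed.

Lemma active_sub x : active x \subset M.
Proof. by apply/fintype.subsetP => i /activeP[]. Qed.

Lemma W_eq J u i : (u <= W J)%MS -> i \in E -> a i u = 0.
Proof. by move=> /orthP H iE; apply: H; rewrite finset.in_setU iE. Qed.

Lemma W_mem J u i : (u <= W J)%MS -> i \in J -> a i u = 0.
Proof. by move=> /orthP H iE; apply: H; rewrite finset.in_setU iE orbT. Qed.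

Lemma W_intro J u : (forall i, i \in E -> a i u = 0) ->
  (forall i, i \in J -> a i u = 0) -> (u <= W J)%MS.
Proof. by move=> H1 H2; apply/orthP => i /finset.setUP[/H1|/H2]. Qed.

Lemma active0 : active z = finset.set0.
Proof.
apply/finset.setP => i; rewrite finset.in_set0; apply/activeP => -[iM iz].
by have := z_int iM; rewrite iz ltxx.
Qed.

(** Inactive constraints have slack and stay strict for small [e]; an active one stays active
    exactly when [u] is orthogonal to its row. *)
Lemma feasible_step x u : P x -> (forall i, i \in E -> a i u = 0) ->
  (forall i, i \in active x -> a i u <= 0) ->
  exists2 e : R, 0 < e &
    P (x + e *: u) /\ active (x + e *: u) = [set i in active x | a i u == 0]%SET.
Proof.
move=> /PE[xE xM] uE ux.
have [|e e0 He] := @exists_lower_bound R 'I_m (fun i => (i \in M) && (i \notin active x))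
   (* Adding [1] keeps the denominator positive when [a i u] is zero. *)
   (fun i => (b i - a i x) / (1 + `|a i u|)).
  move=> i /andP[iM ix]; apply: divr_gt0; last by rewrite ltr_pwDl.
  rewrite subr_gt0 lt_neqAle xM // andbT.
  by apply: contra ix => /eqP ix; apply/activeP.
have slack i : i \in M -> i \notin active x -> a i x + e * a i u < b i.
  move=> iM ix; have := He i; rewrite iM ix => /(_ isT).
  rewrite ler_pdivlMr ?ltr_pwDl // => H.
  have : e * a i u <= e * `|a i u| by rewrite ler_pM2l ?ler_norm.
  by lra.
exists e => //; split.
  apply/PE; split=> i iX; rewrite innerD innerZ; first by rewrite uE // mulr0 addr0 xE.
  have [ix|ix] := boolP (i \in active x); last exact/ltW/slack.
  have [_ ->] := activeP _ _ ix; have := ux _ ix; nra.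
apply/finset.setP => i; rewrite [in RHS]inE; apply/activeP/andP => -[].
  move=> iM; rewrite innerD innerZ => H.
  have [ix|ix] := boolP (i \in active x); last by have := slack _ iM ix; rewrite H ltxx.
  split=> //; have [_ iE] := activeP _ _ ix.
  by move/eqP: H; rewrite iE -subr_eq0 addrAC subrr add0r mulf_eq0 gt_eqF.
by move=> /activeP[iM ix] /eqP iu; rewrite innerD innerZ iu mulr0 addr0.
Qed.

Lemma has_dim_face_of x : P x -> has_dim (face_of (active x)) (\rank (W (active x))).
Proof.
move=> Px; have [xE xM] := iffLR (PE x) Px.
apply: (@has_dim_affine _ _ _ x) => [|y [/PE[yE yM] yx]|u uW].
- by split=> // i /activeP[].
- apply: W_intro => i iX; rewrite innerB; first by rewrite xE // yE // subrr.
  by rewrite yx //; have /activeP[_ ->] := iX; rewrite subrr.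
have [i iE|i iX|e e0 [Pe Ae]] := @feasible_step x u Px.
- exact: W_eq uW iE.
- by rewrite (W_mem uW iX).
exists e => //; split=> // i iX; rewrite innerD innerZ (W_mem uW iX) mulr0 addr0.
by have /activeP[] := iX.
Qed.

(** At a midpoint only the constraints active at both ends are active, so a point with the fewest
    active constraints has the least active set. It plays the part of a relative interior point of
    [G]. *)
Lemma least_active G : G `<=` P -> G !=set0 ->
  (forall x y, G x -> G y -> G (2^-1 *: (x + y))) ->
  exists2 x, G x & forall y, G y -> active x \subset active y.
Proof.
move=> GP [x0 Gx0] Gmid.
have ex : exists k, `[< exists x, G x /\ #|active x| = k >].
  by exists #|active x0|; apply/asboolP; exists x0.
have [k /asboolP[x [Gx xk]] kmin] := ex_minnP ex.
exists x => // y Gy; set w := 2^-1 *: (x + y).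
have wxy : active w \subset active x :&: active y.
  apply/fintype.subsetP => i /activeP[iM]; rewrite innerZ innerD => H.
  have [/PE[_ /(_ _ iM) xi] /PE[_ /(_ _ iM) yi]] := (GP _ Gx, GP _ Gy).
  by apply/finset.setIP; split; apply/activeP; split => //; lra.
have : (k <= #|active w|)%N by apply: kmin; apply/asboolP; exists w; split=> //; exact: Gmid.
rewrite -xk => H; have : active w == active x.
  by rewrite eqEcard H andbT; apply: fintype.subset_trans wxy (finset.subsetIl _ _).
by move/eqP <-; apply: fintype.subset_trans wxy (finset.subsetIr _ _).
Qed.

(** Let [x] have the least active set in [G]. If [y] satisfies the same equalities, a small step
    from [x] away from [y] stays in [P], so the functional defining [G] cannot be smaller at [y]
    than at [x]. *)
Lemma face_eq_face_of G : face P G -> G !=set0 ->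
  exists2 x, P x & G = face_of (active x).
Proof.
move=> [c [bb [cP ->]]] G0; set G' := [set x | _].
have [||x [Px xb] xmin] := @least_active G' _ G0; first by move=> x [].
  move=> x y [/PE[xE xM] xb] [/PE[yE yM] yb]; split; last first.
    by rewrite innerZ innerD xb yb; field.
  apply/PE; split=> i iX; rewrite innerZ innerD; first by rewrite xE // yE //; field.
  by have := xM _ iX; have := yM _ iX; lra.
exists x => //; apply/seteqP; split=> y.
  by move=> Gy; have [Py _] := Gy; split=> // i iX; have /fintype.subsetP := xmin _ Gy => /(_ _ iX)/activeP[].
move=> [Py yx]; split=> //.
have [xE _] := iffLR (PE x) Px; have [yE _] := iffLR (PE y) Py.
have [i iE|i iX|e e0 [Pe _]] := @feasible_step x (x - y) Px.
- by rewrite innerB xE // yE // subrr.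
- by rewrite innerB yx //; have /activeP[_ ->] := iX; rewrite subrr.
have := cP _ Pe; rewrite innerD innerZ innerB xb => H.
apply/eqP; rewrite eq_le cP //=.
rewrite -subr_ge0; have : e * (bb - inner c y) <= 0 by lra.
by rewrite pmulr_rle0 // subr_le0 subr_ge0.
Qed.

(** The sum of the inequalities in [J] is a valid inequality, with equality only where each of them
    is tight. *)
Lemma face_of_face J : J \subset M -> face P (face_of J).
Proof.
move=> /fintype.subsetP JM; exists (\sum_(i in J) row i A), (\sum_(i in J) b i); split.
  by move=> x /PE[_ xM]; rewrite inner_suml; apply: ler_sum => i /JM; apply: xM.
apply/seteqP; split=> x [Px H]; split=> //.
  by rewrite inner_suml; apply: eq_bigr.
move: H; rewrite inner_suml => /eqP; rewrite eq_sym -subr_eq0 -sumrB psumr_eq0; last first.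
  by move=> i iJ; have [_ xM] := iffLR (PE x) Px; rewrite subr_ge0; apply/xM/JM.
by move=> /allP H i iJ; apply/eqP; rewrite eq_sym -subr_eq0; have := H i; rewrite mem_index_enum iJ; apply.
Qed.

Lemma face_of_subset x J : P x -> J \subset M ->
  face_of (active x) `<=` face_of J -> J \subset active x.
Proof.
move=> Px /fintype.subsetP JM H; apply/fintype.subsetP => i iJ.
have [|_ xJ] := H x; first by split=> // j /activeP[].
by apply/activeP; split; [exact: JM|exact: xJ].
Qed.

Lemma face_of_anti J K : J \subset K -> face_of K `<=` face_of J.
Proof. by move=> /fintype.subsetP JK x [Px H]; split=> // i /JK/H. Qed.

(** Irredundancy gives a [y] violating only the constraint [i]. The segment from [z] to [y] meets
    the hyperplane of [i] at a point where all other constraints are still strict, because they are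
    strict at [z]. *)
Lemma facet_point i : i \in M -> exists2 w, P w & active w = [set i]%SET.
Proof.
move=> iM; have [y [yE yM yi]] := irr iM; have zi := z_int iM.
have [zE zM] := iffLR (PE z) Pz.
pose l := (b i - a i z) / (a i y - a i z).
have l0 : 0 < l by rewrite divr_gt0 ?subr_gt0 //; lra.
have l1 : l < 1 by rewrite ltr_pdivrMr; lra.
pose w := z + l *: (y - z).
have wi : a i w = b i by rewrite innerD innerZ innerB /l divfK ?subrKC // subr_eq0 gt_eqF //; lra.
have ws j : j \in M -> j != i -> a j w < b j.
  move=> jM ji; rewrite innerD innerZ innerB.
  by have := yM _ jM ji; have := z_int jM; nra.
exists w.
  apply/PE; split=> j jX; first by rewrite innerD innerZ innerB yE // zE // subrr mulr0 addr0.
  by have [->|ji] := eqVneq j i; [rewrite wi|exact/ltW/ws].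
apply/finset.setP => j; rewrite finset.in_set1; apply/activeP/eqP => [[jM jw]|->//].
by apply/eqP; apply: contraT => /(ws _ jM); rewrite jw ltxx.
Qed.

(** Move along a direction that preserves the active constraints until a new one becomes tight; the
    rank drops each time. *)
Lemma vertex_above x : P x -> exists v,
  [/\ P v, active x \subset active v & \rank (W (active v)) = 0%N].
Proof.
have [k] := ubnP (\rank (W (active x))); elim: k x => // k IH x; rewrite ltnS => xk Px.
have [r0|] := eqVneq (\rank (W (active x))) 0%N; first by exists x.
rewrite mxrank_eq0 => /rowV0Pn[u uW u0].
have [xE xM] := iffLR (PE x) Px.
have [B PB] := Pbounded.
have ray (t : R) : 0 <= t -> (forall i, i \in M -> 0 < a i u -> t * a i u <= b i - a i x) -> P (x + t *: u).
  move=> t0 H; apply/PE; split=> i iX; rewrite innerD innerZ.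
    by rewrite (W_eq uW iX) mulr0 addr0 xE.
  have [ui|ui] := ltP 0 (a i u); first by have := H _ iX ui; lra.
  by have := xM _ iX; nra.
have [i0 i0P] : exists i, (i \in M) && (0 < a i u).
  apply: contrapT => /forallNP H.
  have {}ray t : 0 <= t -> P (x + t *: u).
    by move=> t0; apply: ray => // i iM iu; case: (H i); rewrite iM.
  have /rV0Pn[j uj] := u0.
  have uj0 : 0 < `|u ord0 j| by rewrite normr_gt0.
  have B0 : 0 <= B by apply: le_trans (PB _ Px j); rewrite normr_ge0.
  (* This step moves coordinate [j] by [2 * B + 1], whereas the coordinates of two points of [P]
     differ by at most [2 * B]. *)
  have := PB _ (ray ((2 * B + 1) / `|u ord0 j|) _) j.
  have := PB _ Px j; rewrite !mxE => xj; set t := _ / _.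
  have t0 : 0 <= t by rewrite divr_ge0 //; lra.
  move=> /(_ t0) H1; have := ler_normB (x ord0 j + t * u ord0 j) (x ord0 j).
  rewrite addrAC subrr add0r normrM (ger0_norm t0) /t divfK ?gt_eqF //; lra.
pose ratio i := (b i - a i x) / a i u.
have [j /andP[jM uj] jmin] := @arg_minP _ _ _ i0 (fun i => (i \in M) && (0 < a i u)) ratio i0P.
have t0 : 0 <= ratio j by rewrite divr_ge0 ?subr_ge0 ?xM // ltW.
pose y := x + ratio j *: u.
have Py : P y.
  apply: ray => // i iM iu; rewrite -ler_pdivlMr //; apply: jmin; by rewrite iM.
have xy : active x \subset active y.
  apply/fintype.subsetP => i ix; have /activeP[iM ixb] := ix.
  by apply/activeP; split=> //; rewrite innerD innerZ (W_mem uW ix) mulr0 addr0.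
have jy : j \in active y.
  apply/activeP; split=> //; rewrite innerD innerZ /ratio divfK ?gt_eqF //.
  by rewrite addrC subrK.
have rk : (\rank (W (active y)) < \rank (W (active x)))%N.
  apply: (orth_rank_lt _ uW); first exact: finset.setUS.
  by apply/negP => uy; move: uj; rewrite (W_mem uy jy) ltxx.
have [v [Pv yv rv]] := IH y (leq_trans rk xk) Py.
by exists v; split=> //; apply: fintype.subset_trans yv.
Qed.

Section Dim.
Variable n : nat.
Hypothesis Pdim : has_dim P n.

Lemma rank_W0 : \rank (W finset.set0) = n.
Proof.
have H : P = face_of (active z) by apply/seteqP; split=> [x Px|x []//]; split=> // i; rewrite active0 finset.in_set0.
by apply: has_dim_unique Pdim; rewrite {1}H -active0; apply: has_dim_face_of.
Qed.

Lemma rank_W1 i : i \in M -> n = (\rank (W [set i]%SET)).+1.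
Proof.
move=> iM; apply/eqP; rewrite eqn_leq; apply/andP; split.
  rewrite -rank_W0; have := orth_rank_setU A (E :|: finset.set0) [set i]%SET.
  by rewrite finset.cards1 addn1 finset.setU0.
have [y [yE yM yi]] := irr iM; have [zE _] := iffLR (PE z) Pz.
rewrite -rank_W0; apply: (orth_rank_lt (u := y - z)).
- by apply: finset.setUS; apply: finset.sub0set.
- by apply: W_intro => j; rewrite ?finset.in_set0 // => jE; rewrite innerB yE // zE // subrr.
apply/negP => /W_mem /(_ (finset.set11 i)); rewrite innerB => H.
by have := z_int iM; lra.
Qed.

(** A facet has an active constraint [i], since otherwise its dimension would be [n]. Its direction
    space and that of [i] alone both have rank [n - 1], hence agree, so tightness of [i] forces all
    its other constraints to be tight. *)
Lemma facetsE G : facets P G <-> exists2 i, i \in M & G = face_of [set i]%SET.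
Proof.
split=> [[Gface [k [Gk Pk]]]|[i iM ->]]; last first.
  split; first by apply: face_of_face; rewrite finset.sub1set.
  have [w Pw aw] := facet_point iM; exists (\rank (W [set i]%SET)).
  by split; [rewrite -aw; apply: has_dim_face_of|rewrite -rank_W1].
have [x Px Gx] := face_eq_face_of Gface (has_dim_nonempty Gk).
have xk : \rank (W (active x)) = k.
  by apply: has_dim_unique Gk; rewrite Gx; apply: has_dim_face_of.
have nk := has_dim_unique Pdim Pk.
have [x0|[i ix]] := finset.set_0Vmem (active x).
  by move: xk; rewrite x0 rank_W0 nk => /eqP; rewrite eqn_leq ltnn.
have [iM xi] := activeP _ _ ix; exists i => //; rewrite Gx.
apply/seteqP; split; first by apply: face_of_anti; rewrite finset.sub1set.
move=> y [Py yi]; split=> // j jx; have [jM xj] := activeP _ _ jx.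
have ixs : (W (active x) <= W [set i]%SET)%MS.
  by apply: orthS; apply: finset.setUS; rewrite finset.sub1set.
have Wi : (W [set i]%SET <= W (active x))%MS.
  rewrite -(mxrank_leqif_sup ixs).2 xk; apply/eqP.
  by move: (rank_W1 iM); rewrite nk => -[].
have : (y - x <= W (active x))%MS.
  apply: submx_trans Wi; have [xE _] := iffLR (PE x) Px; have [yE _] := iffLR (PE y) Py.
  apply: W_intro => l lX; rewrite innerB; first by rewrite yE // xE // subrr.
  by rewrite yi //; move: lX; rewrite finset.in_set1 => /eqP ->; rewrite xi subrr.
by move=> /W_mem /(_ jx); rewrite innerB xj => /eqP; rewrite subr_eq0 => /eqP.
Qed.

Lemma face_of1_inj : {in M &, injective (fun i => face_of [set i]%SET)}.
Proof.
move=> i j iM jM ij; have [w Pw aw] := facet_point iM.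
have : [set j]%SET \subset active w.
  by apply: face_of_subset => //; [rewrite finset.sub1set|rewrite aw ij].
by rewrite aw finset.sub1set finset.in_set1 => /eqP.
Qed.

Section Simple.
Hypothesis simple : forall F, faces_of_dim P 0 F ->
  ([set G | facets P G /\ F `<=` G] #= `I_n)%card.

(** The facets through a vertex correspond to its active constraints, so simplicity fixes their
    number. *)
Lemma vertex_card v : P v -> \rank (W (active v)) = 0%N -> #|active v| = n.
Proof.
move=> Pv rv; apply/card_eq_II.
have H : faces_of_dim P 0 (face_of (active v)).
  split; first exact/face_of_face/active_sub.
  by rewrite -rv; apply: has_dim_face_of.
apply: card_eq_trans (simple H).
rewrite card_eq_sym (_ : [set G | _] = (fun i => face_of [set i]%SET) @` [set` active v]).
  apply: card_image_finset => i j /activeP[iM _] /activeP[jM _]; exact: face_of1_inj.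
apply/seteqP; split=> [G [/facetsE[i iM ->] vG]|_ [i iv <-]].
  exists i => //=; rewrite -finset.sub1set; apply: face_of_subset => //.
  by rewrite finset.sub1set.
have /activeP[iM _] := iv.
by split; [apply/facetsE; exists i|apply: face_of_anti; rewrite finset.sub1set].
Qed.

(* At a vertex [v] the [n] active constraints cut the rank from [n] down to
   [0], so each of them has to lower it by exactly one. *)
Lemma rank_W x J : P x -> J \subset active x -> (\rank (W J) + #|J|)%N = n.
Proof.
move=> Px Jx; have [v [Pv xv rv]] := vertex_above Px.
have Jv := fintype.subset_trans Jx xv.
have r0 : \rank (orth A E) = n by rewrite -rank_W0 finset.setU0.
have vJ : J :|: (active v :\: J) = active v.
  apply/finset.setP => i; rewrite !finset.inE; case iJ: (i \in J) => //=.
  by have := fintype.subsetP Jv _ iJ; rewrite !finset.inE.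
have := orth_rank_setU A E J; have := orth_rank_setU A (E :|: J) (active v :\: J).
rewrite -finset.setUA vJ rv r0 finset.cardsD (finset.setIidPr Jv) vertex_card //.
by have := fintype.subset_leq_card Jv; rewrite vertex_card //; lia.
Qed.

(** By independence, each constraint active at [x] can be relaxed by some [v i] that keeps the
    others tight. A small step along the sum of the [v i] with [i] outside [J] relaxes exactly the
    unwanted ones. *)
Lemma exists_active J : J \subset M -> face_of J !=set0 ->
  exists2 y, P y & active y = J.
Proof.
move=> /fintype.subsetP JM [x [Px xJ]].
have Jx : J \subset active x.
  by apply/fintype.subsetP => i iJ; apply/activeP; split; [exact: JM|exact: xJ].
have /choice[v vP] : forall i, exists v : 'rV[R]_d, i \in active x ->
    (v <= W (active x :\ i))%MS /\ a i v < 0.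
  move=> i.
  have [ix|ix] := boolP (i \in active x); last by exists 0.
  have rk : (\rank (W (active x)) < \rank (W (active x :\ i)))%N.
    have := rank_W Px (finset.subD1set (active x) i).
    by have := rank_W Px (fintype.subxx _); rewrite (finset.cardsD1 i (active x)) ix; lia.
  have [u uW nu] := orth_rank_witness (finset.setUS E (finset.subD1set (active x) i)) rk.
  have ui : a i u != 0.
    apply: contra nu => /eqP ui; apply: W_intro => j; first exact: W_eq uW.
    have [->//|ji] := eqVneq j i; move=> jx.
    by apply: W_mem uW _; rewrite finset.in_setD1 ji.
  have [u0|u0] := ltP (a i u) 0; first by exists u.
  exists (- 1 *: u) => _; split; first exact: scalemx_sub.
  by rewrite innerZ mulN1r oppr_lt0 lt_neqAle eq_sym ui.
pose u := \sum_(i in active x :\: J) v i.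
have ui i : i \in active x -> a i u = if i \in J then 0 else a i (v i).
  move=> ix; rewrite inner_sum.
  have v0 j : j \in active x :\: J -> j != i -> a i (v j) = 0.
    rewrite finset.in_setD => /andP[_ jx] ji; have [vW _] := vP _ jx.
    by apply: W_mem vW _; rewrite finset.in_setD1 eq_sym ji.
  have [iJ|iJ] := boolP (i \in J).
    rewrite big1 // => j jD; apply: v0 => //.
    by apply: contraTneq jD => ->; rewrite finset.in_setD iJ.
  rewrite (bigD1 i) /=; last by rewrite finset.in_setD iJ.
  by rewrite big1 ?addr0 // => j /andP[]; apply: v0.
have [i iE|i ix|e e0 [Pe Ae]] := @feasible_step x u Px.
- rewrite inner_sum big1 // => j; rewrite finset.in_setD => /andP[_ jx].
  by have [vW _] := vP _ jx; apply: W_eq vW _.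
- by rewrite ui //; case: ifP => // _; have [_ /ltW] := vP _ ix.
exists (x + e *: u) => //; rewrite Ae; apply/finset.setP => i; rewrite finset.inE.
case ix: (i \in active x) => /=; last by apply/esym/negbTE; apply: contraFN ix => /(fintype.subsetP Jx).
rewrite ui //; case: ifP => //; first by rewrite eqxx.
by move=> _; have [_ /lt_eqF] := vP _ ix.
Qed.

Lemma faces_of_dimE k : faces_of_dim P k = face_of @`
  [set` [set J : {set 'I_m} | [&& J \subset M, `[< face_of J !=set0 >] & (#|J| + k == n)%N]]%SET].
Proof.
apply/seteqP; split=> [G [Gface Gk]|_ [J JX <-]].
  have [x Px Gx] := face_eq_face_of Gface (has_dim_nonempty Gk).
  exists (active x) => //=; rewrite finset.inE; apply/and3P; split; first exact: active_sub.
    by apply/asboolP; rewrite -Gx; apply: has_dim_nonempty Gk.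
  have <- : \rank (W (active x)) = k.
    by apply: has_dim_unique Gk; rewrite Gx; apply: has_dim_face_of.
  by rewrite addnC (rank_W Px (fintype.subxx _)).
move: JX; rewrite /= finset.inE => /and3P[JM /asboolP J0 /eqP Jk].
split; first exact: face_of_face.
have [y Py yJ] := exists_active JM J0.
have := rank_W Py (fintype.subxx _); rewrite yJ -Jk addnC => /addnI <-.
by rewrite -yJ; apply: has_dim_face_of.
Qed.

Lemma face_of_inj : {in [pred J : {set 'I_m} | (J \subset M) && `[< face_of J !=set0 >]] &,
  injective face_of}.
Proof.
have H J K : J \subset M -> K \subset M -> face_of J !=set0 ->
    face_of J = face_of K -> K \subset J.
  move=> JM KM /(exists_active JM)[y Py yJ] JK.
  by rewrite -yJ; apply: face_of_subset => //; rewrite yJ JK.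
move=> J K /andP[JM /asboolP J0] /andP[KM /asboolP K0] JK.
by apply/eqP; rewrite finset.eqEsubset; apply/andP; split; apply: H.
Qed.

End Simple.
End Dim.
End Irredundant.

(** * Face counts in terms of facets, tubes and tubings *)

Section Main.
Variables (R : realType) (d n : nat) (P : set 'rV[R]_d).

(** [z] has the least active set [E], so the constraints in [E] are equations on [P]. [M] is a
    minimal set of remaining inequalities that still cuts out [P]; minimality yields the points
    violating just one of them. *)
Lemma polytope_irredundant : polytope P -> P !=set0 ->
  exists m (A : 'M[R]_(m, d)) (b : 'I_m -> R) (E M : {set 'I_m}) (z : 'rV[R]_d),
  [/\ forall x, P x <-> (forall i, i \in E -> inner (row i A) x = b i) /\
                        (forall i, i \in M -> inner (row i A) x <= b i),
      P z, forall i, i \in M -> inner (row i A) z < b i &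
      forall i, i \in M -> exists y,
        [/\ forall j, j \in E -> inner (row j A) y = b j,
            forall j, j \in M -> j != i -> inner (row j A) y <= b j &
            b i < inner (row i A) y]].
Proof.
move=> [[m [A [b PA]]] _] P0; exists m, A, b.
have PT x : P x <-> (forall i, i \in finset.set0 -> inner (row i A) x = b i) /\
                    (forall i, i \in [set: 'I_m]%SET -> inner (row i A) x <= b i).
  rewrite PA; split=> [H|[_ H] i]; last exact: H.
  by split=> i; rewrite ?finset.in_set0.
have [|z Pz zmin] := least_active PT (@subset_refl _ P) P0.
  move=> x y /PT[_ xM] /PT[_ yM]; apply/PT; split=> i; first by rewrite finset.in_set0.
  by move=> iM; rewrite innerZ innerD; have := xM _ iM; have := yM _ iM; lra.
set E := active A b [set: 'I_m]%SET z in zmin.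
have PE x : P x -> forall i, i \in E -> inner (row i A) x = b i.
  by move=> Px i iE; have /(fintype.subsetP (zmin _ Px))/activeP[] := iE.
pose cuts (M : {set 'I_m}) := `[< forall x,
  (forall i, i \in E -> inner (row i A) x = b i) ->
  (forall i, i \in M -> inner (row i A) x <= b i) -> P x >].
have cutsT : cuts (~: E).
  apply/asboolP => x xE xM; apply/PT; split=> i; first by rewrite finset.in_set0.
  move=> _; have [/xE -> //|iE] := boolP (i \in E).
  by apply: xM; rewrite finset.in_setC.
have [M /minsetP[/asboolP Mcuts Mmin] ME] := minset_exists cutsT.
have Pin x i : P x -> inner (row i A) x <= b i by case/PT => _; apply; rewrite finset.in_setT.
exists E, M, z; split=> // [x|i iM|i iM].
- split=> [Px|[]]; last exact: Mcuts.
  by split=> i iX; [exact: PE|exact: Pin].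
- rewrite lt_neqAle Pin // andbT.
  have := fintype.subsetP ME _ iM; rewrite finset.in_setC; apply: contra => /eqP iz.
  by apply/activeP; split; rewrite ?finset.in_setT.
apply: contrapT => /forallNP H.
suff /Mmin : cuts (M :\ i) by move=> /(_ (finset.subD1set M i))/finset.setP/(_ i); rewrite iM finset.in_setD1 eqxx.
apply/asboolP => x xE xM; apply: Mcuts => // j jM.
have xM' k : k \in M -> k != i -> inner (row k A) x <= b k.
  by move=> kM ki; apply: xM; rewrite finset.in_setD1 ki.
have [->|ji] := eqVneq j i; last exact: xM'.
by rewrite leNgt; apply/negP => xi; apply: (H x).
Qed.

(** The interface to the combinatorial side: of the inequalities only labels of facets survive,
    together with the existence of common points. *)
Theorem card_faces_simple_polytope : simple_polytope n P ->
  exists m (M : {set 'I_m}) (phi : 'I_m -> set 'rV[R]_d),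
  [/\ {in M &, injective phi},
      forall G, facets P G <-> exists2 i, i \in M & G = phi i &
      forall k, #|` fset_set (faces_of_dim P k)|%fset =
        #|[set J : {set 'I_m} | [&& J \subset M,
             `[< exists x, P x /\ forall i, i \in J -> phi i x >] &
             (#|J| + k == n)%N]]%SET|].
Proof.
move=> [Ppol Pdim simple].
have [m [A [b [E [M [z [PE Pz z_int irr]]]]]]] := polytope_irredundant Ppol (has_dim_nonempty Pdim).
have [_ Pbd] := Ppol.
exists m, M, (fun i => face_of A b P [set i]%SET); split.
- exact: (face_of1_inj PE Pz z_int irr).
- exact: (facetsE PE Pz z_int irr Pdim).
move=> k; rewrite (faces_of_dimE PE Pz z_int irr Pbd Pdim simple).
rewrite fset_set_image_card; last first.
  move=> J K; rewrite !finset.inE => /and3P[JM J0 _] /and3P[KM K0 _].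
  by apply: (face_of_inj PE Pz z_int irr Pbd Pdim simple); rewrite !finset.inE ?JM ?KM.
congr #|pred_of_set _|; apply/finset.setP => J; rewrite !finset.inE; congr [&& _, _ & _].
apply: asbool_equiv_eq; split=> [[x [Px xJ]]|[x [Px xJ]]]; exists x; split=> // i iJ.
  by split=> // j; rewrite finset.in_set1 => /eqP ->; apply: xJ.
by have [_] := xJ _ iJ; apply; rewrite finset.set11.
Qed.

End Main.

Lemma card_faces_double_path_associahedron (R : realType) (d n k : nat) (P : set 'rV[R]_d) :
  double_path_associahedron n P ->
  #|` fset_set (faces_of_dim P k)|%fset =
  #|[set S | hc_tubing (@double_path n) S & (#|S| + k == n)%N]%SET|.
Proof.
case=> Psimple [phi [[phiF phiI phiS] phiT]].
have [m [M [psi [psiI psiE ->]]]] := card_faces_simple_polytope Psimple.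
(* [kap] sends the label of a facet to the tube of that facet; the value [finset.set0] outside [M]
   is a placeholder. *)
have /choice[kap kapP] : forall i, exists T : {set pm n}, i \in M ->
    hc_tube (@double_path n) T /\ phi T = psi i.
  move=> i; have [iM|_] := boolP (i \in M); last by exists finset.set0.
  have /phiS[T tT TE] : facets P (psi i) by apply/psiE; exists i.
  by exists T.
have kapI : {in M &, injective kap}.
  move=> i j iM jM ij; apply: psiI => //.
  by have [_ <-] := kapP _ iM; have [_ <-] := kapP _ jM; rewrite ij.
have kapS T : hc_tube (@double_path n) T -> exists2 i, i \in M & T = kap i.
  move=> tT; have /psiE[i iM Ti] := phiF _ tT; exists i => //.
  have [ti kapi] := kapP _ iM.
  by apply: phiI; [exact/mem_set|exact/mem_set|rewrite Ti].
have tube_im (J : {set 'I_m}) : J \subset M -> {in kap @: J, forall T, hc_tube (@double_path n) T}.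
  by move=> /fintype.subsetP JM T /imsetP[i /JM iM ->]; have [] := kapP _ iM.
have tub (J : {set 'I_m}) : J \subset M ->
    hc_tubing (@double_path n) (kap @: J) =
    `[< exists x, P x /\ forall i, i \in J -> psi i x >].
  move=> JM; apply/idP/asboolP.
    move/(iffLR (phiT _ (tube_im _ JM))) => [x [Px H]]; exists x; split=> // i iJ.
    have [_ <-] := kapP _ (fintype.subsetP JM _ iJ); apply: H; exact: imset_f.
  move=> [x [Px H]]; apply: (iffRL (phiT _ (tube_im _ JM))).
  exists x; split=> // T /imsetP[i iJ ->].
  by have [_ ->] := kapP _ (fintype.subsetP JM _ iJ); apply: H.
have cardJ (J : {set 'I_m}) : J \subset M -> #|kap @: J| = #|J|.
  move=> /fintype.subsetP JM; apply: card_in_imset => i j /JM iM /JM jM; exact: kapI.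
rewrite -(card_in_imset (f := fun J : {set 'I_m} => kap @: J)); last first.
  move=> J K; rewrite !finset.inE => /and3P[/fintype.subsetP JM _ _] /and3P[/fintype.subsetP KM _ _] JK.
  have sub (J' K' : {set 'I_m}) : {subset J' <= M} -> {subset K' <= M} ->
      kap @: J' = kap @: K' -> {subset J' <= K'}.
    move=> J'M K'M H i iJ; have : kap i \in kap @: K' by rewrite -H imset_f.
    by case/imsetP=> j jK E; rewrite (kapI _ _ (J'M _ iJ) (K'M _ jK) E).
  by apply/finset.setP => i; apply/idP/idP; apply: sub.
congr #|pred_of_set _|; apply/finset.setP => S; rewrite [in RHS]finset.inE.
apply/imsetP/andP => [[J] |[tS cS]].
  rewrite finset.inE => /and3P[JM Jx Jc] ->.
  by rewrite tub // cardJ.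
have [/forall_inP St _ _] := and3P tS.
pose J := [set i in M | kap i \in S]%SET.
have JM : J \subset M by apply/fintype.subsetP => i; rewrite finset.inE => /andP[].
have SJ : S = kap @: J.
  apply/finset.setP => T; apply/idP/imsetP => [TS|[i]]; last by rewrite finset.inE => /andP[_ iS] ->.
  have [i iM Ti] := kapS _ (St _ TS); exists i => //.
  by rewrite finset.inE iM -Ti.
by exists J => //; rewrite finset.inE JM -tub // -cardJ // -SJ tS.
Qed.

(** Here the faces themselves are indexed by tubings, so uniqueness of the dimension is enough to
    sort them. *)
Lemma card_faces_cyclohedron (R : realType) (d n k : nat) (Q : set 'rV[R]_d) :
  cyclohedron n Q ->
  #|` fset_set (faces_of_dim Q k)|%fset =
  #|[set S | graph_tubing (@cycle_graph n.+1) S & (#|S| + k == n)%N]%SET|.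
Proof.
case=> _ [psi [[psiF psiI psiS] _ psiD]].
rewrite -(@fset_set_image_card _ _ _ psi); last first.
  move=> S T; rewrite !finset.inE => /andP[tS _] /andP[tT _].
  by apply: psiI; exact/mem_set.
congr #|` fset_set _|%fset; apply/seteqP; split=> [F [Fface Fk]|_ [S tS <-]].
  have [S tS SF] := psiS F (conj Fface (has_dim_nonempty Fk)).
  exists S => //=; rewrite finset.inE; apply/andP; split=> //.
  have [l [Sl ln]] := psiD _ tS; rewrite SF in Sl.
  by apply/eqP; rewrite (has_dim_unique Fk Sl) addnC.
move: tS; rewrite /= finset.inE => /andP[tS /eqP Sk].
have [Sface _] := psiF _ tS; split=> //.
have [l [Sl ln]] := psiD _ tS; suff -> : k = l by [].
by apply/eqP; rewrite -(eqn_add2l #|S|) Sk addnC ln.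
Qed.

Theorem proposition6p1p23 (R : realType) (n d1 d2 : nat)
    (P : set 'rV[R]_d1) (Q : set 'rV[R]_d2) :
  double_path_associahedron n P -> cyclohedron n Q ->
  fvector n P = fvector n Q.
Proof.
move=> HP HQ; apply: eq_from_tnth => k; rewrite !tnth_mktuple.
rewrite (card_faces_double_path_associahedron k HP) (card_faces_cyclohedron k HQ).
have kn : (k <= n)%N by rewrite -ltnS.
(* Since [k <= n], the subtraction [n - k] is not truncated. *)
have E (T : finType) (X : {set T}) : (#|X| + k == n)%N = (#|X| == n - k)%N.
  by move: #|X| => c; lia.
under eq_finset do rewrite E; under [in RHS]eq_finset do rewrite E.
exact: card_tubings.
Qed.
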